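(* For every $p\in(1,\infty)$, $$p+\frac{\pi^2}{6}-1-\frac{\pi^2}{6(p+1)}<\lambda(p)<p+\frac{\pi^2}{6}-1 .$$ Therefore, $$\lim_{p\to\infty}\bigl(\lambda(p)-p\bigr)=\frac{\pi^2}{6}-1 .$$
   Context: For $p\in(1,\infty)$, $\lambda(p)$ denotes the first eigenvalue of the one-dimensional $p$-Laplacian with zero Dirichlet boundary conditions on the interval $[-1,1]$, i.e. the first (smallest) $\lambda$ for which the problem $-(|\varphi'|^{p-2}\varphi')'=\lambda|\varphi|^{p-2}\varphi$ on $(-1,1)$, $\varphi(-1)=\varphi(1)=0$, has a nontrivial solution $\varphi$. It is known, and used in the paper as the expression of $\lambda(p)$, that $$\lambda(p)=(p-1)\left(\frac{\pi_p}{2}\right)^p=(p-1)\left(\frac{\pi}{p\sin(\pi/p)}\right)^p,\qquad \pi_p:=2\int_0^1\frac{dt}{(1-t^p)^{1/p}}=\frac{2\pi}{p\sin(\pi/p)} .$$ *)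

(* Defs.v *)
From Stdlib Require Import Reals ClassicalEpsilon.
From Coquelicot Require Import Coquelicot.
Open Scope R_scope.

(* The map s |-> |s|^(p-2) s.  Since [Rpower 0 _ = 1], the value at s = 0 is 0,
   including for p < 2, as in the usual convention. *)
Definition signed_power (p s : R) : R := Rpower (Rabs s) (p - 2) * s.

(* Nontrivial classical solution: phi is differentiable, and so is the flux
   |phi'|^(p-2) phi', in (-1, 1); phi itself need not be twice differentiable
   where phi' = 0.  Only the values of phi on [-1, 1] matter. *)
Definition eigenfunction (p lam : R) (phi : R -> R) : Prop :=
  continuous_on (fun x => -1 <= x <= 1) phi /\
  (forall x, -1 < x < 1 -> ex_derive phi x) /\
  (forall x, -1 < x < 1 ->
     ex_derive (fun y => signed_power p (Derive phi y)) x /\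
     - Derive (fun y => signed_power p (Derive phi y)) x
       = lam * signed_power p (phi x)) /\
  phi (-1) = 0 /\ phi 1 = 0 /\
  (exists x, -1 <= x <= 1 /\ phi x <> 0).

Definition eigenvalue (p lam : R) : Prop :=
  exists phi : R -> R, eigenfunction p lam phi.

Definition first_eigenvalue (p lam : R) : Prop :=
  eigenvalue p lam /\ (forall mu, eigenvalue p mu -> lam <= mu).

(* [first_eigenvalue p] holds of at most one real; [epsilon] selects it.
   Nothing is known about [lambda p] if no smallest eigenvalue exists. *)
Definition lambda (p : R) : R := epsilon (inhabits 0) (first_eigenvalue p).

(* Main.v *)
Require Import Defs.
From Stdlib Require Import Reals Ranalysis5 Lra Lia Classical ClassicalEpsilon.
From Coquelicot Require Import Coquelicot.
Open Scope R_scope.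

(** Let [q = p / (p - 1)] and let [J] be the integral of [1 / (1 + v^q)] over
    [[0, +oo)].  The Riccati variable [w = |phi'|^(p-2) phi' / phi^(p-1)] of a positive
    solution satisfies [w' = - lam - (p - 1) |w|^q] and runs from [+oo] to [-oo]
    between two zeros of [phi].  Inverting [w -> int_0^w dv / (1 + |v|^q)] gives a
    solution vanishing at the two end points, and comparing the time needed to go from
    [+oo] to [-oo] shows that no eigenvalue is smaller: [lambda p = (p - 1) y^p] with
    [y = J / (p - 1)].

    With [t = 1 / p], expanding the integrand geometrically on both sides of [1] gives
    [y = 1 + 2 sum_(n >= 1) (-1)^(n+1) t^2 / (n^2 - t^2)]. Since
    [sum (-1)^(n+1) / n^2 = PI^2 / 12], writing [a = PI^2 / 6 - 1], this yields
    [1 + a t^2 <= y (1 - t^2) <= 1 + a t^2 + (1 - a) t^4].  The lower bound for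
    [lambda p] follows by applying Bernoulli's inequality to [1 / (1 - t^2)] and to
    [1 + a t^2], the upper bound by taking logarithms. *)

(** * Signed powers *)

(** The equation degenerates where [phi'] vanishes, and an eigenfunction is arbitrary: it may change
    sign, and nothing is known outside [[-1, 1]]. The argument therefore never invokes uniqueness
    for the initial value problem or a variational formula. It differentiates only [phi] and the
    flux, and the comparison takes place on an interval where [phi] is positive, the sign being
    settled by oddness.

    [J] enters only as the supremum of the values of an increasing function, together with a
    truncated alternating series. No closed form with a sine is used: the series is the partial
    fraction expansion of [PI t / sin (PI t)], and every passage to the limit is an error of order
    [1 / m] after an even number of terms.

    Since [Rpower 0 x] is [1], powers that must vanish at the origin are written with [signed_power]
    and [abs_power].

    The upper bound is tight to second order in [t] and leaves room only at order [t^3], which is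
    why it needs third-order estimates of logarithms and numerical bounds on [a]. *)

Lemma signed_power_0 (p : R) : signed_power p 0 = 0.
Proof. unfold signed_power; ring. Qed.

Lemma signed_power_pos (p s : R) : 0 < s -> signed_power p s = Rpower s (p - 1).
Proof.
  intros Hs. unfold signed_power. rewrite Rabs_pos_eq by lra.
  replace (p - 1) with ((p - 2) + 1) by ring.
  now rewrite Rpower_plus, Rpower_1.
Qed.

Lemma signed_power_opp (p s : R) : signed_power p (- s) = - signed_power p s.
Proof. unfold signed_power. rewrite Rabs_Ropp; ring. Qed.

Lemma signed_power_scale (p c s : R) : 0 < c ->
  signed_power p (c * s) = Rpower c (p - 1) * signed_power p s.
Proof.
  intros Hc. unfold signed_power.
  destruct (Req_dec s 0) as [->|Hs]; [ring|].
  rewrite Rabs_mult, (Rabs_pos_eq c) by lra.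
  rewrite <- Rpower_mult_distr; [|lra|now apply Rabs_pos_lt].
  replace (p - 1) with ((p - 2) + 1) by ring.
  rewrite Rpower_plus, (Rpower_1 c) by lra. ring.
Qed.

(** For positive [s] this is [(s^(p-1))^(q-1) = s], and both maps are odd. It is the means of
    passing between a derivative and its flux. *)
Lemma signed_power_conj (p q s : R) : (p - 1) * (q - 1) = 1 ->
  signed_power q (signed_power p s) = s.
Proof.
  intros Hpq.
  assert (Hpos : forall r, 0 < r -> signed_power q (signed_power p r) = r).
  { intros r Hr. rewrite (signed_power_pos p r), signed_power_pos; auto.
    - now rewrite Rpower_mult, Hpq, Rpower_1.
    - apply exp_pos. }
  destruct (Rtotal_order s 0) as [Hs|[->|Hs]].
  - replace s with (- - s) at 1 by ring.
    rewrite 2!signed_power_opp, Hpos; lra.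
  - now rewrite !signed_power_0.
  - now apply Hpos.
Qed.

(** Continuity at [0], with [delta = eps^(1/(p-1))]. [Rpower] carries no information there, so the
    point is treated by hand. *)
Lemma signed_power_small (p eps : R) : 1 < p -> 0 < eps ->
  exists delta, 0 < delta /\
    forall s, Rabs s < delta -> Rabs (signed_power p s) < eps.
Proof.
  intros Hp He. exists (Rpower eps (/ (p - 1))). split; [apply exp_pos|].
  assert (Hpos : forall r, 0 < r -> r < Rpower eps (/ (p - 1)) ->
    signed_power p r < eps).
  { intros r Hr Hlt. rewrite signed_power_pos by assumption.
    replace eps with (Rpower (Rpower eps (/ (p - 1))) (p - 1)).
    - apply Rlt_Rpower_l; lra.
    - rewrite Rpower_mult, Rinv_l, Rpower_1; lra. }
  assert (Hpp : forall r, 0 < r -> 0 < signed_power p r).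
  { intros r Hr. rewrite signed_power_pos by assumption. apply exp_pos. }
  intros s Hs.
  destruct (Rtotal_order s 0) as [H|[->|H]].
  - rewrite Rabs_left in Hs by assumption.
    rewrite <- Rabs_Ropp, <- signed_power_opp.
    rewrite Rabs_pos_eq.
    + apply Hpos; lra.
    + apply Rlt_le, Hpp; lra.
  - rewrite signed_power_0, Rabs_R0; assumption.
  - rewrite Rabs_pos_eq in Hs by lra.
    rewrite Rabs_pos_eq; [now apply Hpos | now apply Rlt_le, Hpp].
Qed.

(* [|s|^p] with value [0] at [s = 0], where [Rpower 0 p] is [1]. *)
Definition abs_power (p s : R) : R := signed_power p s * s.

Lemma abs_power_0 (p : R) : abs_power p 0 = 0.
Proof. unfold abs_power; ring. Qed.

Lemma abs_power_ge0 (p s : R) : 0 <= abs_power p s.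
Proof.
  unfold abs_power, signed_power.
  assert (H : 0 < Rpower (Rabs s) (p - 2)) by apply exp_pos.
  rewrite Rmult_assoc. apply Rmult_le_pos; [lra|apply Rle_0_sqr].
Qed.

Lemma abs_power_opp (p s : R) : abs_power p (- s) = abs_power p s.
Proof. unfold abs_power. rewrite signed_power_opp; ring. Qed.

Lemma abs_power_pos (p s : R) : 0 < s -> abs_power p s = Rpower s p.
Proof.
  intros Hs. unfold abs_power. rewrite signed_power_pos by assumption.
  rewrite <- (Rpower_1 s) at 2 by assumption.
  rewrite <- Rpower_plus. f_equal; ring.
Qed.

Lemma is_derive_Rpower (a x : R) : 0 < x ->
  is_derive (fun y => Rpower y a) x (a * Rpower x (a - 1)).
Proof. intros Hx. apply is_derive_Reals. now apply derivable_pt_lim_power. Qed.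

Lemma is_derive_abs_power (p s : R) : 1 < p ->
  is_derive (abs_power p) s (p * signed_power p s).
Proof.
  intros Hp.
  assert (Hpos : forall r, 0 < r -> is_derive (abs_power p) r (p * signed_power p r)).
  { intros r Hr. rewrite signed_power_pos by assumption.
    apply is_derive_ext_loc with (fun y => Rpower y p).
    - exists (mkposreal r Hr). intros y Hy.
      rewrite abs_power_pos; [easy|].
      apply Rabs_def2 in Hy. unfold minus, plus, opp in Hy; simpl in Hy. lra.
    - now apply is_derive_Rpower. }
  destruct (Rtotal_order s 0) as [H|[->|H]].
  - apply is_derive_ext with (fun y => abs_power p (- y)).
    { intros y. apply abs_power_opp. }
    replace (p * signed_power p s) with (-1 * (p * signed_power p (- s)))
      by (rewrite signed_power_opp; ring).
    apply is_derive_comp with (f := abs_power p) (g := fun y => - y).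
    + apply Hpos; lra.
    + auto_derive; [easy|ring].
  (* At [0] the difference quotient is [signed_power p h] itself. *)
  - rewrite signed_power_0, Rmult_0_r. apply is_derive_Reals.
    intros eps He. destruct (signed_power_small p eps Hp He) as [d [Hd Hs]].
    exists (mkposreal d Hd). intros h Hh Hhd. simpl in Hhd.
    rewrite Rplus_0_l, abs_power_0. unfold abs_power.
    replace ((signed_power p h * h - 0) / h - 0) with (signed_power p h)
      by (field; assumption).
    now apply Hs.
  - now apply Hpos.
Qed.

(** * The sum of the inverse squares *)

Lemma mean_value (f df : R -> R) (a b : R) : a <= b ->
  (forall x, a <= x <= b -> is_derive f x (df x)) ->
  exists c, a <= c <= b /\ f b - f a = df c * (b - a).
Proof.
  intros Hab Hd.
  destruct (MVT_gen f a b df) as [c [Hc He]].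
  - intros x Hx. rewrite Rmin_left, Rmax_right in Hx by lra. apply Hd; lra.
  - intros x Hx. rewrite Rmin_left, Rmax_right in Hx by lra.
    apply continuity_pt_filterlim.
    apply (ex_derive_continuous f x). exists (df x). apply Hd; lra.
  - rewrite Rmin_left, Rmax_right in Hc by lra. now exists c.
Qed.

Lemma incr_of_derive_ge0 (f df : R -> R) (a b : R) : a <= b ->
  (forall x, a <= x <= b -> is_derive f x (df x)) ->
  (forall x, a <= x <= b -> 0 <= df x) -> f a <= f b.
Proof.
  intros Hab Hd Hp. destruct (mean_value f df a b Hab Hd) as [c [Hc He]].
  assert (H : 0 <= df c * (b - a)) by (apply Rmult_le_pos; [now apply Hp|lra]). lra.
Qed.

Lemma strict_incr_of_derive_pos (f df : R -> R) (a b : R) : a < b ->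
  (forall x, a <= x <= b -> is_derive f x (df x)) ->
  (forall x, a <= x <= b -> 0 < df x) -> f a < f b.
Proof.
  intros Hab Hd Hp. destruct (mean_value f df a b (Rlt_le _ _ Hab) Hd) as [c [Hc He]].
  assert (H : 0 < df c * (b - a)) by (apply Rmult_lt_0_compat; [now apply Hp|lra]). lra.
Qed.

(** Integrating by parts relates these integrals to the moments [wallis2] in such a way that the
    quotients [wallis2 n / wallis n] telescope to the inverse squares. *)
Definition wallis (n : nat) : R := RInt (fun x => cos x ^ (2 * n)) 0 (PI / 2).
Definition wallis2 (n : nat) : R :=
  RInt (fun x => x ^ 2 * cos x ^ (2 * n)) 0 (PI / 2).

Lemma ex_RInt_wallis (n : nat) (a b : R) : ex_RInt (fun x => cos x ^ (2 * n)) a b.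
Proof.
  apply (@ex_RInt_continuous R_CompleteNormedModule). intros x _.
  apply (@ex_derive_continuous _ R_NormedModule). now auto_derive.
Qed.

Lemma ex_RInt_wallis2 (n : nat) (a b : R) :
  ex_RInt (fun x => x ^ 2 * cos x ^ (2 * n)) a b.
Proof.
  apply (@ex_RInt_continuous R_CompleteNormedModule). intros x _.
  apply (@ex_derive_continuous _ R_NormedModule). now auto_derive.
Qed.

Lemma RInt_of_derive (F f g h : R -> R) (al be a b : R) :
  (forall x, is_derive F x (f x)) -> (forall x, continuous f x) ->
  (forall x, f x = al * g x + be * h x) -> ex_RInt g a b -> ex_RInt h a b ->
  F b - F a = al * RInt g a b + be * RInt h a b.
Proof.
  intros HF Hc Hf Hg Hh.
  assert (H1 : is_RInt f a b (F b - F a)).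
  { apply (is_RInt_derive (V := R_CompleteNormedModule)); intros x _; auto. }
  rewrite <- (is_RInt_unique f a b (F b - F a) H1).
  apply is_RInt_unique.
  apply (is_RInt_ext (fun x => plus (scal al (g x)) (scal be (h x)))).
  { intros x _. rewrite Hf. reflexivity. }
  apply (is_RInt_plus (V := R_NormedModule)); apply (is_RInt_scal (V := R_NormedModule));
    now apply (RInt_correct (V := R_CompleteNormedModule)).
Qed.

Lemma sin2_eq (x : R) : sin x * sin x = 1 - cos x * cos x.
Proof. generalize (sin2_cos2 x). unfold Rsqr. intros; nra. Qed.

Lemma wallis_S (n : nat) :
  2 * INR (S n) * wallis (S n) = (2 * INR n + 1) * wallis n.
Proof.
  assert (H : sin (PI / 2) * cos (PI / 2) ^ (2 * n + 1) - sin 0 * cos 0 ^ (2 * n + 1) =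
    2 * INR (S n) * wallis (S n) + - (2 * INR n + 1) * wallis n).
  { apply RInt_of_derive with (F := fun x => sin x * cos x ^ (2 * n + 1))
      (f := fun x => 2 * INR (S n) * cos x ^ (2 * S n)
                     + - (2 * INR n + 1) * cos x ^ (2 * n)).
    - intros x. auto_derive; [easy|].
      replace (2 * S n)%nat with (S (S (2 * n))) by lia.
      replace (Init.Nat.pred (n + (n + 0) + 1)) with (2 * n)%nat by lia.
      replace (n + (n + 0) + 1)%nat with (S (2 * n)) by lia.
      replace (n + (n + 0))%nat with (2 * n)%nat by lia.
      rewrite !S_INR, mult_INR. change (INR 2) with 2.
      rewrite <- !tech_pow_Rmult.
      generalize (sin2_eq x). generalize (cos x ^ (2 * n)). intros r Hs.
      transitivity (cos x * cos x * r - (sin x * sin x) * (2 * INR n + 1) * r); [ring|].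
      rewrite Hs. ring.
    - intros x. apply (@ex_derive_continuous _ R_NormedModule). now auto_derive.
    - reflexivity.
    - apply ex_RInt_wallis.
    - apply ex_RInt_wallis. }
  rewrite cos_PI2, sin_0, pow_i in H by lia. lra.
Qed.

Lemma wallis_wallis2 (n : nat) :
  wallis (S n) = (2 * INR n + 1) * INR (S n) * wallis2 n
                 - 2 * INR (S n) ^ 2 * wallis2 (S n).
Proof.
  (* Two integrations by parts in one antiderivative: the terms in [x sin x cos^(2n+1)] cancel, and
     [F] vanishes at both ends. *)
  set (F := fun x => x * cos x ^ (2 * S n)
                     + INR (S n) * x ^ 2 * sin x * cos x ^ (2 * n + 1)).
  assert (H : F (PI / 2) - F 0 = 1 * wallis (S n) + - 1 *
    ((2 * INR n + 1) * INR (S n) * wallis2 n - 2 * INR (S n) ^ 2 * wallis2 (S n))).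
  { set (h := fun x => (2 * INR n + 1) * INR (S n) * (x ^ 2 * cos x ^ (2 * n))
       + - (2 * INR (S n) ^ 2) * (x ^ 2 * cos x ^ (2 * S n))).
    assert (Hh : is_RInt h 0 (PI / 2)
      ((2 * INR n + 1) * INR (S n) * wallis2 n - 2 * INR (S n) ^ 2 * wallis2 (S n))).
    { unfold Rminus. rewrite Ropp_mult_distr_l.
      apply (is_RInt_plus (V := R_NormedModule)); apply (is_RInt_scal (V := R_NormedModule));
      apply (RInt_correct (V := R_CompleteNormedModule)), ex_RInt_wallis2. }
    rewrite <- (is_RInt_unique _ _ _ _ Hh).
    apply RInt_of_derive with
      (f := fun x => 1 * cos x ^ (2 * S n) + - 1 * h x).
    - intros x. unfold F, h. auto_derive; [easy|].
      change (n + S (n + 0))%nat with (Init.Nat.pred (2 * S n)).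
      replace (Init.Nat.pred (2 * S n)) with (S (2 * n)) by lia.
      replace (2 * S n)%nat with (S (S (2 * n))) by lia.
      replace (Init.Nat.pred (n + (n + 0) + 1)) with (2 * n)%nat by lia.
      replace (n + (n + 0) + 1)%nat with (S (2 * n)) by lia.
      replace (n + (n + 0))%nat with (2 * n)%nat by lia.
      rewrite ?S_INR, ?mult_INR. change (INR 2) with 2.
      rewrite <- !tech_pow_Rmult.
      generalize (sin2_eq x). generalize (cos x ^ (2 * n)). intros r Hs.
      (* The added term is zero by the Pythagorean identity; it makes the equality a polynomial
         one. *)
      match goal with |- ?l = ?m =>
        transitivity (l + (INR n + 1) * x ^ 2 * (2 * INR n + 1) * r * (sin x * sin x - (1 - cos x * cos x)));
        [rewrite Hs; ring|simpl; change (match n with 0%nat => 1 | S _ => INR n + 1 end) with (INR (S n)); rewrite S_INR; ring] end.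
    - intros x. apply (@ex_derive_continuous _ R_NormedModule). unfold h. now auto_derive.
    - reflexivity.
    - apply ex_RInt_wallis.
    - exists ((2 * INR n + 1) * INR (S n) * wallis2 n - 2 * INR (S n) ^ 2 * wallis2 (S n)).
      exact Hh. }
  unfold F in H. rewrite cos_PI2, sin_0, !pow_i in H by lia. lra.
Qed.

Lemma wallis_pos (n : nat) : 0 < wallis n.
Proof.
  induction n as [|n IH].
  - unfold wallis. simpl. rewrite RInt_const. unfold scal; simpl; unfold mult; simpl.
    generalize PI_RGT_0; lra.
  - assert (H := wallis_S n). rewrite S_INR in H. assert (Hn := pos_INR n).
    apply Rmult_lt_reg_l with (2 * (INR n + 1)); [lra|].
    rewrite H, Rmult_0_r. apply Rmult_lt_0_compat; lra.
Qed.

(** Divide [wallis_wallis2] by [(n+1)^2 wallis (n+1)] and turn the first denominator into [wallis n]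
    with [wallis_S]. *)
Lemma inv_sqr_wallis (n : nat) :
  / INR (S n) ^ 2 = 2 * (wallis2 n / wallis n) - 2 * (wallis2 (S n) / wallis (S n)).
Proof.
  assert (HA := wallis_pos n). assert (HA' := wallis_pos (S n)).
  assert (H1 := wallis_S n). assert (H2 := wallis_wallis2 n).
  assert (Hn := pos_INR n). rewrite S_INR in *.
  assert (HW : wallis n = 2 * (INR n + 1) * wallis (S n) / (2 * INR n + 1))
    by (rewrite H1; field; lra).
  assert (HB : wallis2 n = (wallis (S n) + 2 * (INR n + 1) ^ 2 * wallis2 (S n))
     / ((2 * INR n + 1) * (INR n + 1))) by (rewrite H2 at 1; field; lra).
  rewrite HW, HB. field. repeat split; lra.
Qed.

Lemma x_cos_le_sin (x : R) : 0 <= x <= PI / 2 -> x * cos x <= sin x.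
Proof.
  intros Hx.
  enough (0 - 0 * cos 0 <= sin x - x * cos x) by lra. rewrite <- sin_0 at 1.
  apply incr_of_derive_ge0 with (f := fun x => sin x - x * cos x)
    (df := fun x => x * sin x); [easy| |].
  - intros y _. auto_derive; [easy|ring].
  - intros y Hy. apply Rmult_le_pos; [easy|apply sin_ge_0; lra].
Qed.

(** From [x cos x <= sin x], the integrand is at most [sin^2 x cos^(2n) x], whose integral is
    [wallis n - wallis (S n)], that is [wallis (S n) / (2n+1)]. *)
Lemma wallis2_bound (n : nat) :
  0 <= wallis2 (S n) /\ (2 * INR n + 1) * wallis2 (S n) <= wallis (S n).
Proof.
  assert (HPI := PI_RGT_0).
  split.
  - apply RInt_ge_0; [lra|apply ex_RInt_wallis2|].
    intros x Hx. apply Rmult_le_pos; [nra|].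
    apply pow_le. apply cos_ge_0; lra.
  - assert (H : wallis2 (S n) <= 1 * wallis n + -1 * wallis (S n)).
    { assert (Hd : is_RInt (fun x => 1 * cos x ^ (2 * n) + -1 * cos x ^ (2 * S n)) 0 (PI / 2)
        (1 * wallis n + -1 * wallis (S n))).
      { apply (is_RInt_plus (V := R_NormedModule)); apply (is_RInt_scal (V := R_NormedModule));
        apply (RInt_correct (V := R_CompleteNormedModule)), ex_RInt_wallis. }
      rewrite <- (is_RInt_unique _ _ _ _ Hd).
      apply RInt_le; [lra|apply ex_RInt_wallis2|now exists (1 * wallis n + -1 * wallis (S n))|].
      intros x Hx.
      replace (2 * S n)%nat with (S (S (2 * n))) by lia. rewrite <- !tech_pow_Rmult.
      assert (Hc : 0 <= cos x) by (apply cos_ge_0; lra).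
      assert (Hp := pow_le (cos x) (2 * n) Hc).
      assert (Hs : x * cos x <= sin x) by (apply x_cos_le_sin; lra).
      assert (Hxc : 0 <= x * cos x) by (apply Rmult_le_pos; lra).
      assert (Hsq : (x * cos x) * (x * cos x) <= 1 - cos x * cos x)
        by (rewrite <- sin2_eq; now apply Rmult_le_compat).
      assert (Hm := Rmult_le_compat_r _ _ _ Hp Hsq). simpl in *. lra. }
    assert (H1 := wallis_S n). assert (Hn := pos_INR n). rewrite S_INR in *.
    assert (Hm : (2 * INR n + 1) * wallis2 (S n) <=
      (2 * INR n + 1) * (1 * wallis n + -1 * wallis (S n)))
      by (apply Rmult_le_compat_l; lra).
    nra.
Qed.

(** A telescoping sum starting from [2 * (wallis2 0 / wallis 0) = PI^2 / 6]. *)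
Lemma sum_inv_sqr (n : nat) :
  sum_f_R0 (fun k => / INR (S k) ^ 2) n
  = PI ^ 2 / 6 - 2 * (wallis2 (S n) / wallis (S n)).
Proof.
  induction n as [|n IH].
  - cbn [sum_f_R0]. rewrite inv_sqr_wallis.
    enough (2 * (wallis2 0 / wallis 0) = PI ^ 2 / 6) by lra.
    unfold wallis, wallis2.
    change (fun x => cos x ^ (2 * 0)) with (fun _ : R => 1).
    rewrite RInt_const.
    assert (H : is_RInt (fun x => x ^ 2 * cos x ^ (2 * 0)) 0 (PI / 2)
      ((PI / 2) ^ 3 / 3 - 0 ^ 3 / 3)).
    { apply (is_RInt_derive (V := R_CompleteNormedModule) (fun x => x ^ 3 / 3)); intros x _.
      - auto_derive; [easy|simpl; field].
      - apply (@ex_derive_continuous _ R_NormedModule). now auto_derive. }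
    rewrite (is_RInt_unique _ _ _ _ H).
    unfold scal; simpl; unfold mult; simpl. field. generalize PI_RGT_0; lra.
  - rewrite tech5, IH, (inv_sqr_wallis (S n)). ring.
Qed.

Lemma sum_inv_sqr_bound (n : nat) :
  Rabs (sum_f_R0 (fun k => / INR (S k) ^ 2) n - PI ^ 2 / 6) <= 2 / (INR n + 1).
Proof.
  rewrite sum_inv_sqr. destruct (wallis2_bound n) as [H0 H1].
  assert (HA := wallis_pos (S n)). assert (Hn := pos_INR n).
  set (r := wallis2 (S n) / wallis (S n)).
  assert (Hr : wallis2 (S n) = r * wallis (S n)) by (unfold r; field; lra).
  assert (Hr0 : 0 <= r) by (apply Rdiv_le_0_compat; lra).
  rewrite Hr in H1.
  assert (H2 : (2 * INR n + 1) * r <= 1) by (apply Rmult_le_reg_r with (wallis (S n)); lra).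
  replace (PI ^ 2 / 6 - 2 * r - PI ^ 2 / 6) with (- (2 * r)) by ring.
  rewrite Rabs_Ropp, Rabs_pos_eq by lra.
  apply Rmult_le_reg_r with (INR n + 1); [lra|].
  replace (2 / (INR n + 1) * (INR n + 1)) with 2 by (field; lra). nra.
Qed.

(** Subtract twice the terms with even denominators; [2 / (2j)^2] is half of [1 / j^2]. The last
    index [2 m + 1] means [2 m + 2] terms. *)
Lemma sum_alt_inv_sqr (m : nat) :
  sum_f_R0 (fun k => (-1) ^ k * / INR (S k) ^ 2) (2 * m + 1)
  = sum_f_R0 (fun k => / INR (S k) ^ 2) (2 * m + 1)
    - sum_f_R0 (fun k => / INR (S k) ^ 2) m / 2.
Proof.
  induction m as [|m IH].
  - simpl. field.
  - replace (2 * S m + 1)%nat with (S (S (2 * m + 1))) by lia.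
    rewrite !tech5, IH.
    replace (S (2 * m + 1)) with (2 * S m)%nat by lia.
    rewrite pow_1_even, pow_1_odd.
    assert (Hm := pos_INR m).
    rewrite !S_INR, mult_INR, !S_INR. simpl INR. field. lra.
Qed.

Lemma sum_alt_inv_sqr_bound (m : nat) :
  Rabs (sum_f_R0 (fun k => (-1) ^ k * / INR (S k) ^ 2) (2 * m + 1) - PI ^ 2 / 12)
  <= 3 / (INR m + 1).
Proof.
  rewrite sum_alt_inv_sqr.
  assert (H1 := sum_inv_sqr_bound (2 * m + 1)). assert (H2 := sum_inv_sqr_bound m).
  assert (Hm := pos_INR m).
  assert (H3 : 2 / (INR (2 * m + 1) + 1) <= 2 / (INR m + 1)).
  { apply Rmult_le_compat_l; [lra|]. apply Rinv_le_contravar; [lra|].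
    rewrite plus_INR, mult_INR; simpl. lra. }
  replace (3 / (INR m + 1)) with (2 / (INR m + 1) + 2 / (INR m + 1) / 2) by (field; lra).
  apply Rabs_le_between in H1, H2. apply Rabs_le_between. lra.
Qed.

(** * The generalised arctangent and its limit *)

(** The remainder is exactly [(-1)^(N+1) y^(N+1) / (1 + y)]. *)
Lemma alt_geometric (y : R) (N : nat) : 0 <= y ->
  Rabs (/ (1 + y) - sum_f_R0 (fun k => (-1) ^ k * y ^ k) N) <= y ^ S N.
Proof.
  intros Hy.
  assert (H : / (1 + y) - sum_f_R0 (fun k => (-1) ^ k * y ^ k) N
    = (-1) ^ S N * (y ^ S N / (1 + y))).
  { induction N as [|N IH].
    - simpl. field. lra.
    - rewrite tech5.
      replace (/ (1 + y) - (sum_f_R0 (fun k => (-1) ^ k * y ^ k) N + (-1) ^ S N * y ^ S N))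
        with ((/ (1 + y) - sum_f_R0 (fun k => (-1) ^ k * y ^ k) N) - (-1) ^ S N * y ^ S N)
        by ring.
      rewrite IH. simpl. field. lra. }
  rewrite H, Rabs_mult, pow_1_abs, Rmult_1_l.
  assert (Hp := pow_le y (S N) Hy).
  rewrite Rabs_pos_eq by (apply Rdiv_le_0_compat; lra).
  apply Rmult_le_reg_r with (1 + y); [lra|].
  unfold Rdiv. rewrite Rmult_assoc, Rinv_l by lra. nra.
Qed.

(** The ordinary arctangent for [q = 2]. With [abs_power] the integrand is even and has the correct
    value [1] at [v = 0]. *)
Definition gen_arctan (q w : R) : R := RInt (fun v => / (1 + abs_power q v)) 0 w.

Lemma is_derive_eq (f : R -> R) (x l l' : R) :
  is_derive f x l -> l = l' -> is_derive f x l'.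
Proof. now intros H <-. Qed.

Section GenArctan.
Variable q : R.
Hypothesis Hq : 1 < q.

Lemma one_plus_abs_power (v : R) : 1 <= 1 + abs_power q v.
Proof. generalize (abs_power_ge0 q v); lra. Qed.

Lemma is_derive_gen_arctan (w : R) : is_derive (gen_arctan q) w (/ (1 + abs_power q w)).
Proof.
  assert (Hc : forall x, continuous (fun v => / (1 + abs_power q v)) x).
  { intros x. apply (@ex_derive_continuous _ R_NormedModule).
    auto_derive. split; [exists (q * signed_power q x); now apply is_derive_abs_power|].
    split; [|easy]. generalize (one_plus_abs_power x); lra. }
  apply (is_derive_RInt (V := R_CompleteNormedModule)
    (fun v => / (1 + abs_power q v)) (gen_arctan q) 0).
  - apply filter_forall. intros x. apply (RInt_correct (V := R_CompleteNormedModule)).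
    apply (ex_RInt_continuous (V := R_CompleteNormedModule)). intros; apply Hc.
  - apply Hc.
Qed.

Lemma gen_arctan_0 : gen_arctan q 0 = 0.
Proof. unfold gen_arctan. now rewrite RInt_point. Qed.

Lemma gen_arctan_incr (a b : R) : a < b -> gen_arctan q a < gen_arctan q b.
Proof.
  intros Hab.
  apply strict_incr_of_derive_pos with (df := fun v => / (1 + abs_power q v)); [easy| |].
  - intros x _. apply is_derive_gen_arctan.
  - intros x _. apply Rinv_0_lt_compat. generalize (one_plus_abs_power x); lra.
Qed.

Lemma gen_arctan_opp (w : R) : gen_arctan q (- w) = - gen_arctan q w.
Proof.
  assert (Hd : forall y, is_derive (fun x => gen_arctan q x + gen_arctan q (- x)) y 0).
  { intros y. auto_derive.
    - split; [|split]; try easy; eexists; apply is_derive_gen_arctan.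
    - change (fun x => gen_arctan q x) with (gen_arctan q).
      rewrite (is_derive_unique _ _ _ (is_derive_gen_arctan y)).
      rewrite (is_derive_unique _ _ _ (is_derive_gen_arctan (- y))).
      rewrite abs_power_opp. ring. }
  enough (gen_arctan q w + gen_arctan q (- w) = gen_arctan q 0 + gen_arctan q (- 0))
    by (rewrite Ropp_0, gen_arctan_0 in *; lra).
  (* [MVT_gen] does not ask for ordered end points, so both signs of [w] are covered. *)
  destruct (MVT_gen (fun x => gen_arctan q x + gen_arctan q (- x)) 0 w (fun _ => 0)) as [c [_ He]].
  - intros x _. apply Hd.
  - intros x _. apply continuity_pt_filterlim.
    apply (ex_derive_continuous (fun x => gen_arctan q x + gen_arctan q (- x)) x). eexists; apply Hd.
  - simpl in He. lra.
Qed.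

Lemma is_derive_v_abs_power_pow (k : nat) (v : R) :
  is_derive (fun v => v * abs_power q v ^ k) v ((INR k * q + 1) * abs_power q v ^ k).
Proof.
  assert (Hd := is_derive_abs_power q v Hq).
  auto_derive; [eexists; exact Hd|].
  change (fun x => abs_power q x) with (abs_power q).
  rewrite (is_derive_unique _ _ _ Hd).
  destruct k as [|k]; [simpl; ring|].
  rewrite <- tech_pow_Rmult. simpl Init.Nat.pred.
  generalize (abs_power q v ^ k) (INR (S k)); intros r m. unfold abs_power. ring.
Qed.

Lemma is_derive_v_abs_power_inv_pow (k : nat) (v : R) : 0 < v ->
  is_derive (fun v => v * (/ abs_power q v) ^ k) v
    ((1 - INR k * q) * (/ abs_power q v) ^ k).
Proof.
  intros Hv.
  assert (Hd := is_derive_abs_power q v Hq).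
  assert (Ha : abs_power q v <> 0)
    by (rewrite abs_power_pos by assumption; apply Rgt_not_eq, exp_pos).
  auto_derive; [split; [eexists; exact Hd|auto]|].
  change (fun x => abs_power q x) with (abs_power q).
  rewrite (is_derive_unique _ _ _ Hd).
  destruct k as [|k]; [simpl; ring|].
  rewrite <- tech_pow_Rmult. simpl Init.Nat.pred.
  assert (Hs : signed_power q v = abs_power q v / v) by (unfold abs_power; field; lra).
  rewrite Hs. generalize (pow (/ abs_power q v) k) (INR (S k)); intros r m.
  field. split; assumption || lra.
Qed.

Lemma is_derive_sum_f_R0 (f df : nat -> R -> R) (x : R) (N : nat) :
  (forall k, is_derive (f k) x (df k x)) ->
  is_derive (fun y => sum_f_R0 (fun k => f k y) N) x (sum_f_R0 (fun k => df k x) N).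
Proof.
  intros H. induction N as [|N IH]; simpl; [apply H|].
  now apply (is_derive_plus (V := R_NormedModule)).
Qed.

(** Both [g - f] and [g + f] are nondecreasing. This serves to integrate an error estimate through
    antiderivatives alone. *)
Lemma abs_diff_le_of_derive (f df g dg : R -> R) (a b : R) : a <= b ->
  (forall x, a <= x <= b -> is_derive f x (df x)) ->
  (forall x, a <= x <= b -> is_derive g x (dg x)) ->
  (forall x, a <= x <= b -> Rabs (df x) <= dg x) ->
  Rabs (f b - f a) <= g b - g a.
Proof.
  intros Hab Hf Hg Hle.
  assert (H1 : g a - f a <= g b - f b).
  { apply incr_of_derive_ge0 with (f := fun x => g x - f x) (df := fun x => dg x - df x);
      [easy| |].
    - intros x Hx. apply (is_derive_minus (V := R_NormedModule)); auto.
    - intros x Hx. specialize (Hle x Hx). apply Rabs_le_between in Hle. lra. }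
  assert (H2 : g a + f a <= g b + f b).
  { apply incr_of_derive_ge0 with (f := fun x => g x + f x) (df := fun x => dg x + df x);
      [easy| |].
    - intros x Hx. apply (is_derive_plus (V := R_NormedModule)); auto.
    - intros x Hx. specialize (Hle x Hx). apply Rabs_le_between in Hle. lra. }
  apply Rabs_le_between. lra.
Qed.

Lemma abs_power_1 : abs_power q 1 = 1.
Proof. rewrite abs_power_pos by lra. unfold Rpower. rewrite ln_1, Rmult_0_r. apply exp_0. Qed.

(** Integrate [alt_geometric] with [y = v^q] over [[0, 1]]. *)
Lemma gen_arctan_1_series (N : nat) :
  Rabs (gen_arctan q 1 - sum_f_R0 (fun k => (-1) ^ k * / (INR k * q + 1)) N)
  <= / (INR (S N) * q + 1).
Proof.
  assert (Hk : forall k, 0 < INR k * q + 1)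
    by (intros k; generalize (pos_INR k); nra).
  assert (H := abs_diff_le_of_derive
    (fun v => gen_arctan q v
      - sum_f_R0 (fun k => (-1) ^ k * / (INR k * q + 1) * (v * abs_power q v ^ k)) N)
    (fun v => / (1 + abs_power q v) - sum_f_R0 (fun k => (-1) ^ k * abs_power q v ^ k) N)
    (fun v => / (INR (S N) * q + 1) * (v * abs_power q v ^ S N))
    (fun v => abs_power q v ^ S N) 0 1).
  cbv beta in H.
  rewrite abs_power_1, gen_arctan_0, !pow1, !Rmult_1_r, Rmult_0_l, Rmult_0_r, Rminus_0_r in H.
  rewrite (sum_eq _ (fun k => (-1) ^ k * / (INR k * q + 1)) N) in H
    by (intros; rewrite pow1; ring).
  rewrite (sum_eq (fun k => _ * (0 * _)) (fun k => 0) N) in H by (intros; ring).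
  rewrite sum_cte, Rmult_0_l, !Rminus_0_r in H.
  apply H; [lra| | |].
  - intros x _. apply (is_derive_minus (V := R_NormedModule)); [now apply is_derive_gen_arctan|].
    apply is_derive_sum_f_R0 with
      (f := fun k v => (-1) ^ k * / (INR k * q + 1) * (v * abs_power q v ^ k))
      (df := fun k v => (-1) ^ k * abs_power q v ^ k).
    intros k.
    eapply is_derive_eq.
    + apply (is_derive_scal (fun v => v * abs_power q v ^ k)).
      apply is_derive_v_abs_power_pow.
    + cbv beta. field. specialize (Hk k); lra.
  - intros x _.
    eapply is_derive_eq.
    + apply (is_derive_scal (fun v => v * abs_power q v ^ S N)).
      apply is_derive_v_abs_power_pow.
    + cbv beta. field. specialize (Hk (S N)); lra.
  - intros x _. apply alt_geometric, abs_power_ge0.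
Qed.

(** Beyond [1] the expansion is in [y = v^(-q)], since [1 / (1 + v^q) = y / (1 + y)]. The error
    bound does not depend on [M], so that [M] can tend to infinity. *)
Lemma gen_arctan_tail_series (N : nat) (M : R) : 1 <= M ->
  Rabs (gen_arctan q M - gen_arctan q 1
    - sum_f_R0 (fun k => (-1) ^ k * / (INR (S k) * q - 1)
                         * (1 - M * (/ abs_power q M) ^ S k)) N)
  <= / (INR (S (S N)) * q - 1).
Proof.
  intros HM.
  assert (Hk : forall k, 0 < INR (S k) * q - 1)
    by (intros k; rewrite S_INR; generalize (pos_INR k); nra).
  set (F := fun k v => (-1) ^ k * / (INR (S k) * q - 1) * (1 - v * (/ abs_power q v) ^ S k)).
  assert (HF1 : forall k, F k 1 = 0)
    by (intros k; unfold F; rewrite abs_power_1, Rinv_1, pow1; ring).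
  assert (H := abs_diff_le_of_derive
    (fun v => gen_arctan q v - sum_f_R0 (fun k => F k v) N)
    (fun v => / (1 + abs_power q v)
       - sum_f_R0 (fun k => (-1) ^ k * (/ abs_power q v) ^ S k) N)
    (fun v => - (/ (INR (S (S N)) * q - 1) * (v * (/ abs_power q v) ^ S (S N))))
    (fun v => (/ abs_power q v) ^ S (S N)) 1 M HM).
  cbv beta in H.
  rewrite (sum_eq (fun k => F k 1) (fun k => 0) N) in H by (intros; apply HF1).
  rewrite sum_cte, Rmult_0_l, abs_power_1, Rinv_1, pow1, Rminus_0_r in H.
  change (Rabs (gen_arctan q M - gen_arctan q 1 - sum_f_R0 (fun k => F k M) N)
    <= / (INR (S (S N)) * q - 1)).
  replace (gen_arctan q M - gen_arctan q 1 - sum_f_R0 (fun k => F k M) N)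
    with (gen_arctan q M - sum_f_R0 (fun k => F k M) N - gen_arctan q 1) by ring.
  assert (Hinv : forall v, 0 < v -> 0 < / abs_power q v).
  { intros v Hv. apply Rinv_0_lt_compat. rewrite abs_power_pos by assumption. apply exp_pos. }
  assert (Hpos : 0 <= / (INR (S (S N)) * q - 1) * (M * (/ abs_power q M) ^ S (S N))).
  { apply Rmult_le_pos; [apply Rlt_le, Rinv_0_lt_compat, Hk|].
    apply Rmult_le_pos; [lra|]. apply pow_le, Rlt_le, Hinv. lra. }
  (* The end point term at [M] only decreases the bound and is dropped. *)
  eapply Rle_trans; [apply H|lra]; clear H.
  - intros x Hx. apply (is_derive_minus (V := R_NormedModule)); [now apply is_derive_gen_arctan|].
    apply is_derive_sum_f_R0 with (f := F)
      (df := fun k v => (-1) ^ k * (/ abs_power q v) ^ S k).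
    intros k. unfold F.
    eapply is_derive_eq.
    + apply (is_derive_scal (fun v => 1 - v * (/ abs_power q v) ^ S k)).
      apply (is_derive_minus (V := R_NormedModule)); [apply @is_derive_const|].
      apply is_derive_v_abs_power_inv_pow; lra.
    + change ((-1) ^ k * / (INR (S k) * q - 1) *
        (0 - (1 - INR (S k) * q) * (/ abs_power q x) ^ S k)
        = (-1) ^ k * (/ abs_power q x) ^ S k).
      generalize ((/ abs_power q x) ^ S k) (Hk k). intros r Hr. field. lra.
  - intros x Hx.
    eapply is_derive_eq.
    + apply (is_derive_opp (V := R_NormedModule)).
      apply (is_derive_scal (fun v => v * (/ abs_power q v) ^ S (S N))).
      apply is_derive_v_abs_power_inv_pow; lra.
    + change (- (/ (INR (S (S N)) * q - 1) *
        ((1 - INR (S (S N)) * q) * (/ abs_power q x) ^ S (S N)))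
        = (/ abs_power q x) ^ S (S N)).
      generalize ((/ abs_power q x) ^ S (S N)) (Hk (S N)). intros r Hr. field. lra.
  - intros x Hx.
    assert (Hx' : 0 < / abs_power q x) by (apply Hinv; lra).
    assert (Ha : abs_power q x <> 0) by (intros E; rewrite E, Rinv_0 in Hx'; lra).
    set (y := / abs_power q x) in *.
    assert (Hy : abs_power q x = / y) by (unfold y; now rewrite Rinv_inv).
    rewrite Hy.
    replace (/ (1 + / y) - sum_f_R0 (fun k => (-1) ^ k * y ^ S k) N)
      with (y * (/ (1 + y) - sum_f_R0 (fun k => (-1) ^ k * y ^ k) N)).
    + rewrite Rabs_mult, (Rabs_pos_eq y) by lra. rewrite <- (tech_pow_Rmult y (S N)).
      apply Rmult_le_compat_l; [lra|]. apply alt_geometric; lra.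
    + rewrite Rmult_minus_distr_l, scal_sum. f_equal; [field; lra|].
      apply sum_eq. intros i _. simpl. ring.
Qed.

(** For [v > 1] one factor [v^(-q)] suffices: the product is at most [v^(1-q)], and [1 - q < 0]. *)
Lemma is_lim_v_abs_power_inv_pow (k : nat) :
  is_lim (fun v => v * (/ abs_power q v) ^ S k) p_infty 0.
Proof.
  assert (H : is_lim (fun v => exp ((1 - q) * ln v)) p_infty 0).
  { apply is_lim_comp with m_infty.
    - apply is_lim_exp_m.
    - replace m_infty with (Rbar_mult (1 - q) p_infty).
      + apply is_lim_scal_l, is_lim_ln_p.
      + simpl. destruct (Rle_dec 0 (1 - q)); [exfalso; lra|easy].
    - now exists 0. }
  apply is_lim_le_le_loc with (f := fun _ => 0) (g := fun v => exp ((1 - q) * ln v));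
    [|apply is_lim_const|exact H].
  exists 1. intros v Hv.
  assert (Hi : / abs_power q v = Rpower v (- q))
    by (rewrite abs_power_pos by lra; now rewrite Rpower_Ropp).
  rewrite Hi.
  assert (H0 : 0 < Rpower v (- q)) by apply exp_pos.
  assert (H1 : Rpower v (- q) <= 1).
  { rewrite <- (Rpower_O v) by lra. apply Rle_Rpower; lra. }
  split; [apply Rmult_le_pos; [lra|apply pow_le; lra]|].
  change (exp ((1 - q) * ln v)) with (Rpower v (1 - q)).
  replace (Rpower v (1 - q)) with (v * Rpower v (- q)).
  - apply Rmult_le_compat_l; [lra|]. simpl.
    assert (Rpower v (- q) ^ k <= 1) by (rewrite <- (pow1 k); apply pow_incr; lra).
    nra.
  - unfold Rminus. now rewrite Rpower_plus, Rpower_1 by lra.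
Qed.

Lemma is_lim_sum_f_R0 (f : nat -> R -> R) (l : nat -> R) (x : Rbar) (N : nat) :
  (forall k, is_lim (f k) x (l k)) ->
  is_lim (fun y => sum_f_R0 (fun k => f k y) N) x (sum_f_R0 l N).
Proof.
  intros H. induction N as [|N IH]; simpl; [apply H|].
  now apply is_lim_plus'.
Qed.

(** [J] is the integral over the half-line, obtained as a supremum. That it is approached but not
    attained is what inversion and comparison need; the series is for the numerical bounds. *)
Lemma gen_arctan_limit : exists J : R,
  (forall w, gen_arctan q w < J) /\ (forall y, y < J -> exists w, y < gen_arctan q w) /\
  forall N, Rabs (J - sum_f_R0 (fun k => (-1) ^ k *
      (/ (INR k * q + 1) + / (INR (S k) * q - 1))) N)
    <= / (INR (S N) * q + 1) + / (INR (S (S N)) * q - 1).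
Proof.
  (* The tail expansion with [N = 0] bounds the values beyond [1]. *)
  assert (Hub : bound (fun y => exists w, y = gen_arctan q w)).
  { exists (gen_arctan q 1 + / (1 * q - 1) + / (2 * q - 1)). intros y [w ->].
    destruct (Rle_dec w 1) as [Hw|Hw].
    - assert (0 < / (1 * q - 1)) by (apply Rinv_0_lt_compat; lra).
      assert (0 < / (2 * q - 1)) by (apply Rinv_0_lt_compat; lra).
      destruct Hw as [Hw| ->]; [generalize (gen_arctan_incr w 1 Hw)|]; lra.
    - assert (H := gen_arctan_tail_series 0 w ltac:(lra)). simpl in H.
      replace (1 + 1) with 2 in H by ring.
      apply Rabs_le_between in H.
      assert (0 < / (1 * q - 1)) by (apply Rinv_0_lt_compat; lra).
      assert (0 < / abs_power q w)
       by (apply Rinv_0_lt_compat; rewrite abs_power_pos by lra; apply exp_pos).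
      assert (0 <= / (1 * q - 1) * (w * / abs_power q w))
        by (apply Rmult_le_pos; [lra|apply Rmult_le_pos; lra]).
      lra. }
  destruct (completeness _ Hub) as [J [HJ1 HJ2]]; [now exists (gen_arctan q 0), 0|].
  assert (HJ : forall w, gen_arctan q w < J).
  { intros w. apply Rlt_le_trans with (gen_arctan q (w + 1)); [apply gen_arctan_incr; lra|].
    apply HJ1. now exists (w + 1). }
  assert (HJs : forall y, y < J -> exists w, y < gen_arctan q w).
  { intros y Hy. apply NNPP. intros Hn.
    enough (J <= y) by lra. apply HJ2. intros z [w ->].
    apply Rnot_lt_le. intros Hlt. apply Hn. now exists w. }
  exists J. split; [exact HJ|split; [exact HJs|]].
  intros N.
  assert (Hlim : is_lim (gen_arctan q) p_infty J).
  { apply is_lim_spec. intros eps. destruct (HJs (J - eps)) as [w Hw].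
    { generalize (cond_pos eps); lra. }
    exists w. intros x Hx. specialize (HJ x). apply Rabs_def1.
    - generalize (cond_pos eps); lra.
    - generalize (gen_arctan_incr w x Hx); lra. }
  set (S1 := sum_f_R0 (fun k => (-1) ^ k * / (INR k * q + 1)) N).
  set (S2 := sum_f_R0 (fun k => (-1) ^ k * / (INR (S k) * q - 1)) N).
  assert (HS : sum_f_R0 (fun k => (-1) ^ k *
      (/ (INR k * q + 1) + / (INR (S k) * q - 1))) N = S1 + S2).
  { unfold S1, S2. rewrite <- sum_plus. apply sum_eq. intros; ring. }
  rewrite HS.
  assert (H2 : Rabs (J - gen_arctan q 1 - S2) <= / (INR (S (S N)) * q - 1)).
  { assert (HL : is_lim (fun M => gen_arctan q M - gen_arctan q 1
      - sum_f_R0 (fun k => (-1) ^ k * / (INR (S k) * q - 1)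
                           * (1 - M * (/ abs_power q M) ^ S k)) N) p_infty
      (J - gen_arctan q 1 - S2)).
    { apply is_lim_minus'; [apply is_lim_minus'; [exact Hlim|apply is_lim_const]|].
      apply is_lim_sum_f_R0 with
        (f := fun k M => (-1) ^ k * / (INR (S k) * q - 1)
                           * (1 - M * (/ abs_power q M) ^ S k)).
      intros k.
      replace (Finite ((-1) ^ k * / (INR (S k) * q - 1))) with
        (Rbar_mult ((-1) ^ k * / (INR (S k) * q - 1)) (Finite (1 - 0)))
        by (simpl; f_equal; ring).
      apply is_lim_scal_l. apply is_lim_minus'; [apply is_lim_const|].
      apply is_lim_v_abs_power_inv_pow. }
    assert (HLa := is_lim_Rabs _ _ _ HL).
    refine (is_lim_le_loc _ (fun _ => / (INR (S (S N)) * q - 1)) _ _ _ _ HLa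
      (is_lim_const _ _)).
    exists 1. intros M HM. apply gen_arctan_tail_series; lra. }
  assert (H1 := gen_arctan_1_series N). fold S1 in H1.
  apply Rabs_le_between in H1, H2. apply Rabs_le_between. lra.
Qed.
End GenArctan.

(** * Bounds on the half-period *)

(** Regroup across consecutive indices: [t/(n-t)] from [k = n-1] and [t/(n+t)] from [k = n] have
    opposite signs and combine to [2 t^2 / (n^2 - t^2)]. The leading [1] is [t/(0+t)]; the last
    fraction stays unpaired. *)
Lemma sum_csc_pairs (t : R) (N : nat) : 0 < t < 1 ->
  sum_f_R0 (fun k => (-1) ^ k * (t / (INR k + t) + t / (INR k + 1 - t))) (S N)
  = 1 + 2 * t ^ 2 * sum_f_R0 (fun k => (-1) ^ k / (INR (S k) ^ 2 - t ^ 2)) N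
    + (-1) ^ S N * (t / (INR N + 2 - t)).
Proof.
  intros Ht. induction N as [|N IH].
  - simpl. field. repeat split; nra.
  - rewrite tech5, IH, (tech5 _ N). assert (HN := pos_INR N).
    rewrite <- !tech_pow_Rmult, !S_INR.
    generalize ((-1) ^ N); intros r. field. repeat split; nra.
Qed.

(** Uses [1/(n^2-t^2) = 1/n^2 + t^2 / (n^2 (n^2-t^2))]: the first part tends to [PI^2 / 12], the
    second is a correction of higher order. *)
Lemma sum_alt_inv_split (t : R) (N : nat) : 0 < t < 1 ->
  sum_f_R0 (fun k => (-1) ^ k / (INR (S k) ^ 2 - t ^ 2)) N
  = sum_f_R0 (fun k => (-1) ^ k * / INR (S k) ^ 2) N
    + t ^ 2 * sum_f_R0 (fun k => (-1) ^ k * / (INR (S k) ^ 2 * (INR (S k) ^ 2 - t ^ 2))) N.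
Proof.
  intros Ht. rewrite scal_sum, <- sum_plus. apply sum_eq. intros k _.
  assert (Hk := pos_INR k). rewrite S_INR. field. nra.
Qed.

(** Leibniz: terms pair off with constant sign. Keeping the last term in the induction makes the
    upper bound inductive. *)
Lemma alt_sum_bounds (e : nat -> R) (m : nat) :
  (forall k, 0 <= e k) -> (forall k, e (S k) <= e k) ->
  e 0%nat - e 1%nat <= sum_f_R0 (fun k => (-1) ^ k * e k) (2 * m + 1) <= e 0%nat.
Proof.
  intros He Hd.
  enough (H : e 0%nat - e 1%nat <= sum_f_R0 (fun k => (-1) ^ k * e k) (2 * m + 1)
    <= e 0%nat - e (2 * m + 1)%nat) by (specialize (He (2 * m + 1)%nat); lra).
  induction m as [|m IH].
  - simpl. lra.
  - replace (2 * S m + 1)%nat with (S (S (2 * m + 1))) by lia.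
    rewrite !tech5.
    replace (S (2 * m + 1)) with (2 * S m)%nat in * by lia.
    rewrite pow_1_even, pow_1_odd.
    assert (H1 := Hd (2 * m + 1)%nat). assert (H2 := Hd (2 * S m)%nat).
    replace (S (2 * m + 1)) with (2 * S m)%nat in H1 by lia. lra.
Qed.

Lemma csc_series_bounds (t : R) (m : nat) : 0 < t < 1 ->
  1 / (1 - t ^ 2) - 1 / (4 * (4 - t ^ 2))
  <= sum_f_R0 (fun k => (-1) ^ k * / (INR (S k) ^ 2 * (INR (S k) ^ 2 - t ^ 2))) (2 * m + 1)
  <= 1 / (1 - t ^ 2).
Proof.
  intros Ht.
  assert (H := alt_sum_bounds (fun k => / (INR (S k) ^ 2 * (INR (S k) ^ 2 - t ^ 2))) m).
  cbv beta in H. change (INR 1) with 1 in H. change (INR 2) with 2 in H.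
  replace (/ (1 ^ 2 * (1 ^ 2 - t ^ 2))) with (1 / (1 - t ^ 2)) in H by (field; nra).
  replace (/ (2 ^ 2 * (2 ^ 2 - t ^ 2))) with (1 / (4 * (4 - t ^ 2))) in H
    by (field; nra).
  apply H.
  - intros k. cbv beta. assert (Hk := pos_INR k). rewrite S_INR.
    apply Rlt_le, Rinv_0_lt_compat, Rmult_lt_0_compat; nra.
  - intros k. cbv beta. assert (Hk := pos_INR k). rewrite !S_INR.
    apply Rinv_le_contravar; [apply Rmult_lt_0_compat; nra|].
    apply Rmult_le_compat; nra.
Qed.

(** The Archimedean property in place of a limit of the truncated series. *)
Lemma Rle_of_le_plus_inv (x y C : R) :
  (forall m : nat, x <= y + C / (INR m + 1)) -> x <= y.
Proof.
  intros H. apply Rnot_lt_le. intros Hlt.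
  destruct (nfloor_ex (Rmax 0 (C / (x - y)))) as [n [_ Hn]]; [apply Rmax_l|].
  specialize (H n).
  assert (Hc : C / (x - y) < INR n + 1) by (eapply Rle_lt_trans; [apply Rmax_r|exact Hn]).
  assert (Hn0 := pos_INR n).
  assert (C < (INR n + 1) * (x - y)).
  { apply Rmult_lt_compat_r with (r := x - y) in Hc; [|lra].
    unfold Rdiv in Hc. rewrite Rmult_assoc, Rinv_l in Hc by lra. lra. }
  assert (C / (INR n + 1) < x - y); [|lra].
  apply Rmult_lt_reg_r with (INR n + 1); [lra|].
  unfold Rdiv. rewrite Rmult_assoc, Rinv_l by lra. lra.
Qed.

(* [J / (p - 1)] is [pi_p / 2], and [q] is the conjugate exponent of [p = 1 / t]. *)
Lemma pi_p_bounds (t q J : R) : 0 < t < 1 -> q * (1 - t) = 1 ->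
  (forall N, Rabs (J - sum_f_R0 (fun k => (-1) ^ k *
      (/ (INR k * q + 1) + / (INR (S k) * q - 1))) N)
    <= / (INR (S N) * q + 1) + / (INR (S (S N)) * q - 1)) ->
  let I := J * t / (1 - t) in
  1 + (PI ^ 2 / 6) * t ^ 2 + 2 * t ^ 4 * (1 / (1 - t ^ 2) - 1 / (4 * (4 - t ^ 2))) <= I
  <= 1 + (PI ^ 2 / 6) * t ^ 2 + 2 * t ^ 4 * (1 / (1 - t ^ 2)).
Proof.
  intros Ht Hq HJ I.
  assert (Hq' : q = / (1 - t)) by (rewrite <- (Rinv_r_simpl_l (1 - t) q) by lra; rewrite Hq; field; lra).
  (* The last index is [S (2 * m + 1)] because pairing lowers it by one, and the paired sum must
     have an even number of terms. *)
  assert (HI : forall m, Rabs (I - sum_f_R0 (fun k => (-1) ^ k *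
      (t / (INR k + t) + t / (INR k + 1 - t))) (S (2 * m + 1)))
      <= 2 / (1 - t) / (INR m + 1)).
  { intros m. specialize (HJ (S (2 * m + 1))).
    set (U := sum_f_R0 _ _) in HJ. set (V := sum_f_R0 _ _).
    assert (HUV : U * (t / (1 - t)) = V).
    { unfold U, V. rewrite Rmult_comm, scal_sum. apply sum_eq. intros k _.
      assert (Hk := pos_INR k). rewrite Hq', S_INR. field.
      repeat split; nra. }
    replace (I - V) with ((J - U) * (t / (1 - t))) by (rewrite <- HUV; unfold I; field; lra).
    rewrite Rabs_mult, (Rabs_pos_eq (t / (1 - t))) by (apply Rdiv_le_0_compat; lra).
    eapply Rle_trans.
    { apply Rmult_le_compat_r; [apply Rdiv_le_0_compat; lra|exact HJ]. }
    assert (Hm := pos_INR m).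
    rewrite !S_INR, plus_INR, mult_INR, Hq'. simpl INR.
    set (z := INR m) in *.
    replace (2 / (1 - t) / (z + 1)) with (/ (1 - t) / (z + 1) + / (1 - t) / (z + 1)) by (field; lra).
    rewrite Rmult_plus_distr_r. apply Rplus_le_compat.
    - replace (/ (((1 + 1) * z + 1 + 1 + 1) * / (1 - t) + 1) * (t / (1 - t)))
        with (t / (2 * z + 4 - t)) by (field; split; lra).
      apply Rmult_le_reg_r with ((1 - t) * (z + 1) * (2 * z + 4 - t)); [repeat apply Rmult_lt_0_compat; lra|].
      replace (t / (2 * z + 4 - t) * ((1 - t) * (z + 1) * (2 * z + 4 - t)))
        with (t * (1 - t) * (z + 1)) by (field; lra).
      replace (/ (1 - t) / (z + 1) * ((1 - t) * (z + 1) * (2 * z + 4 - t)))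
        with (2 * z + 4 - t) by (field; lra).
      nra.
    - replace (/ (((1 + 1) * z + 1 + 1 + 1 + 1) * / (1 - t) - 1) * (t / (1 - t)))
        with (t / (2 * z + 3 + t)) by (field; split; lra).
      apply Rmult_le_reg_r with ((1 - t) * (z + 1) * (2 * z + 3 + t)); [repeat apply Rmult_lt_0_compat; lra|].
      replace (t / (2 * z + 3 + t) * ((1 - t) * (z + 1) * (2 * z + 3 + t)))
        with (t * (1 - t) * (z + 1)) by (field; lra).
      replace (/ (1 - t) / (z + 1) * ((1 - t) * (z + 1) * (2 * z + 3 + t)))
        with (2 * z + 3 + t) by (field; lra).
      nra. }
  (* The correction [D] depends on [m], but its bounds do not. The three constants are the errors of
     the series for [J], of the alternating inverse squares ([2 t^2] times [3 / (m+1)]), and of the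
     unpaired term. *)
  assert (Hall : forall m, exists x D,
     I = 1 + PI ^ 2 / 6 * t ^ 2 + 2 * t ^ 4 * D + x /\
     Rabs x <= (2 / (1 - t) + 6 + 1) / (INR m + 1) /\
     1 / (1 - t ^ 2) - 1 / (4 * (4 - t ^ 2)) <= D <= 1 / (1 - t ^ 2)).
  { intros m. assert (HI' := HI m).
    rewrite sum_csc_pairs, sum_alt_inv_split in HI' by assumption.
    assert (HD := csc_series_bounds t m Ht).
    assert (HE := sum_alt_inv_sqr_bound m).
    set (D := sum_f_R0 (fun k => (-1) ^ k * / (INR (S k) ^ 2 * _)) _) in *.
    set (E := sum_f_R0 (fun k => (-1) ^ k * / INR (S k) ^ 2) _) in *.
    exists (I - (1 + PI ^ 2 / 6 * t ^ 2 + 2 * t ^ 4 * D)), D.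
    split; [ring|split; [|exact HD]].
    set (W := (-1) ^ S (2 * m + 1) * (t / (INR (2 * m + 1) + 2 - t))) in *.
    assert (Hm := pos_INR m).
    assert (HW : Rabs W <= 1 / (INR m + 1)).
    { unfold W. rewrite Rabs_mult, pow_1_abs, Rmult_1_l.
      rewrite plus_INR, mult_INR. simpl INR.
      rewrite Rabs_pos_eq by (apply Rdiv_le_0_compat; lra).
      apply Rmult_le_reg_r with ((INR m + 1) * ((1 + 1) * INR m + 1 + 2 - t)); [apply Rmult_lt_0_compat; lra|].
      replace (t / ((1 + 1) * INR m + 1 + 2 - t) * ((INR m + 1) * ((1 + 1) * INR m + 1 + 2 - t)))
        with (t * (INR m + 1)) by (field; lra).
      replace (1 / (INR m + 1) * ((INR m + 1) * ((1 + 1) * INR m + 1 + 2 - t)))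
        with (2 * INR m + 3 - t) by (field; lra). nra. }
    replace ((2 / (1 - t) + 6 + 1) / (INR m + 1)) with
      (2 / (1 - t) / (INR m + 1) + 2 * (3 / (INR m + 1)) + 1 / (INR m + 1)) by (field; lra).
    replace (I - (1 + PI ^ 2 / 6 * t ^ 2 + 2 * t ^ 4 * D)) with
      ((I - (1 + 2 * t ^ 2 * (E + t ^ 2 * D) + W)) + 2 * t ^ 2 * (E - PI ^ 2 / 12) + W)
      by field.
    assert (HT : Rabs (2 * t ^ 2 * (E - PI ^ 2 / 12)) <= 2 * (3 / (INR m + 1))).
    { rewrite Rabs_mult, (Rabs_pos_eq (2 * t ^ 2)) by nra.
      apply Rmult_le_compat; [nra|apply Rabs_pos|nra|exact HE]. }
    apply Rabs_le_between in HI', HT, HW. apply Rabs_le_between. lra. }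
  assert (Ht4 : 0 < t ^ 4) by (apply pow_lt; lra).
  split; apply Rle_of_le_plus_inv with (2 / (1 - t) + 6 + 1); intros m;
    destruct (Hall m) as [x [D [HE [Hx HD]]]]; apply Rabs_le_between in Hx.
  - assert (2 * t ^ 4 * (1 / (1 - t ^ 2) - 1 / (4 * (4 - t ^ 2))) <= 2 * t ^ 4 * D)
      by (apply Rmult_le_compat_l; lra). lra.
  - assert (2 * t ^ 4 * D <= 2 * t ^ 4 * (1 / (1 - t ^ 2)))
      by (apply Rmult_le_compat_l; lra). lra.
Qed.

(** * From the half-period to the eigenvalue *)

Lemma PI_bounds : 31 / 10 < PI < 32 / 10.
Proof.
  assert (H := PI_ineq 12). unfold tg_alt, PI_tg in H. simpl in H. lra.
Qed.

Lemma exp_quadratic_lower (z : R) : 0 <= z -> 1 + z + z ^ 2 / 2 <= exp z.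
Proof.
  intros Hz.
  enough (exp 0 - (1 + 0 + 0 ^ 2 / 2) <= exp z - (1 + z + z ^ 2 / 2))
    by (rewrite exp_0 in *; simpl in *; lra).
  apply incr_of_derive_ge0 with (f := fun z => exp z - (1 + z + z ^ 2 / 2))
    (df := fun z => exp z - (1 + z)); [easy| |].
  - intros x _. auto_derive; [easy|simpl; field].
  - intros x _. generalize (exp_ineq1_le x); lra.
Qed.

Lemma ln_quadratic_lower (x : R) : 0 <= x -> x - x ^ 2 / 2 <= ln (1 + x).
Proof.
  intros Hx.
  enough (ln (1 + 0) - (0 - 0 ^ 2 / 2) <= ln (1 + x) - (x - x ^ 2 / 2))
    by (rewrite Rplus_0_r, ln_1 in *; simpl in *; lra).
  apply incr_of_derive_ge0 with (f := fun x => ln (1 + x) - (x - x ^ 2 / 2))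
    (df := fun x => x ^ 2 / (1 + x)); [easy| |].
  - intros y Hy. auto_derive; [lra|simpl; field; lra].
  - intros y Hy. apply Rdiv_le_0_compat; [nra|lra].
Qed.

(** The cubic gain pays for the quadratic loss in [ln (1 + a t)] in the upper estimate. It follows
    by differentiating twice; the second derivative factors with a visibly nonnegative numerator. *)
Lemma ln_entropy_bound (t : R) : 0 <= t < 1 ->
  - (1 - t) * ln (1 - t) - ln (1 + t) <= - t ^ 3 / 3.
Proof.
  intros Ht.
  assert (Hd : forall x, 0 <= x <= t -> ln (1 - x) + x / (1 + x) + x ^ 2 <= 0).
  { intros x Hx.
    enough (- (ln (1 - 0) + 0 / (1 + 0) + 0 ^ 2) <= - (ln (1 - x) + x / (1 + x) + x ^ 2))
      by (rewrite Rminus_0_r, ln_1 in *; simpl in *; lra).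
    apply incr_of_derive_ge0 with (f := fun x => - (ln (1 - x) + x / (1 + x) + x ^ 2))
      (df := fun x => / (1 - x) - / (1 + x) ^ 2 - 2 * x); [lra| |].
    - intros y Hy. auto_derive; [lra|simpl; field; lra].
    - intros y Hy.
      replace (/ (1 - y) - / (1 + y) ^ 2 - 2 * y) with
        (y * (1 - y + 2 * y ^ 2 + 2 * y ^ 3) / ((1 - y) * (1 + y) ^ 2)) by (field; lra).
      apply Rdiv_le_0_compat; [|apply Rmult_lt_0_compat; nra].
      apply Rmult_le_pos; [lra|].
      assert (0 <= y ^ 2) by nra. assert (0 <= y ^ 3) by (apply pow_le; lra). lra. }
  enough (- (- (1 - 0) * ln (1 - 0) - ln (1 + 0) + 0 ^ 3 / 3)
    <= - (- (1 - t) * ln (1 - t) - ln (1 + t) + t ^ 3 / 3))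
    by (rewrite Rminus_0_r, Rplus_0_r, ln_1 in *; simpl in *; lra).
  apply incr_of_derive_ge0
    with (f := fun t => - (- (1 - t) * ln (1 - t) - ln (1 + t) + t ^ 3 / 3))
    (df := fun x => - (ln (1 - x) + x / (1 + x) + x ^ 2)); [lra| |].
  - intros y Hy. auto_derive; [lra|unfold Rminus; simpl; field; lra].
  - intros y Hy. specialize (Hd y Hy). lra.
Qed.

(** The conclusion is the logarithmic form of [y^p < (p + a) / (p - 1)] with [p = 1 / t]. An
    exponent [z] is placed between the two sides after [ln (1 - t^2)] has been added to both. *)
Lemma upper_estimate (a t y : R) : 6 / 10 < a < 71 / 100 -> 0 < t < 1 ->
  0 < y -> y * (1 - t ^ 2) <= 1 + a * t ^ 2 + (1 - a) * t ^ 4 ->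
  ln y < t * ln (1 + (1 + a) * t / (1 - t)).
Proof.
  intros Ha Ht Hy Hyt.
  (* [z] collects what the logarithmic bounds give on the right: [t^3 / 3] from [ln_entropy_bound]
     and [a t^2 - a^2 t^3 / 2] from [t ln (1 + a t)]. *)
  set (d := 1 / 3 - a ^ 2 / 2).
  set (z := a * t ^ 2 + d * t ^ 3).
  assert (Hd : 0 < d) by (unfold d; nra).
  assert (Ht3 : 0 < t ^ 3) by (apply pow_lt; lra).
  assert (Hpoly : 0 < d - (1 - a - a ^ 2 / 2) * t + a * d * t ^ 2).
  { (* Concave in [a]: compare with the chord between [a = 6/10] and [a = 71/100]. *)
    set (P := fun b => (1 / 3 - b ^ 2 / 2) - (1 - b - b ^ 2 / 2) * t
                       + b * (1 / 3 - b ^ 2 / 2) * t ^ 2).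
    assert (H1 : 0 < P (6 / 10)) by (unfold P; nra).
    assert (H2 : 0 < P (71 / 100)) by (unfold P; nra).
    assert (H3 : 0 <= 1 / 2 - t / 2 + (a + 131 / 100) / 2 * t ^ 2) by nra.
    assert (H4 : P a = ((71 / 100 - a) * P (6 / 10) + (a - 6 / 10) * P (71 / 100)) * (100 / 11)
      + (a - 6 / 10) * (71 / 100 - a) * (1 / 2 - t / 2 + (a + 131 / 100) / 2 * t ^ 2))
      by (unfold P; field).
    assert (H5 := Rmult_lt_0_compat (71 / 100 - a) _ ltac:(lra) H1).
    assert (H6 := Rmult_lt_0_compat (a - 6 / 10) _ ltac:(lra) H2).
    assert (H7 : 0 <= (a - 6 / 10) * (71 / 100 - a)) by nra.
    assert (H8 := Rmult_le_pos _ _ H7 H3).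
    change (0 < P a). lra. }
  assert (Hz0 : 0 <= z) by (unfold z; nra).
  (* [1 + z + z^2 / 2] exceeds the left side by [t^3] times the polynomial of [Hpoly], plus the
     square [(d t^3)^2 / 2]. *)
  assert (Hexp : 1 + a * t ^ 2 + (1 - a) * t ^ 4 < exp z).
  { eapply Rlt_le_trans; [|apply exp_quadratic_lower, Hz0].
    assert (H := Rmult_lt_0_compat _ _ Ht3 Hpoly).
    assert (H' : 0 <= (d * t ^ 3) ^ 2) by apply pow2_ge_0.
    unfold z in *. nra. }
  assert (Hln : ln y + ln (1 - t) + ln (1 + t) < z).
  { rewrite <- !ln_mult by (try apply Rmult_lt_0_compat; lra).
    rewrite <- (ln_exp z). apply ln_increasing; [repeat apply Rmult_lt_0_compat; lra|].
    replace (y * (1 - t) * (1 + t)) with (y * (1 - t ^ 2)) by ring. lra. }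
  replace (1 + (1 + a) * t / (1 - t)) with ((1 + a * t) * / (1 - t)) by (field; lra).
  assert (Hat : 0 < a * t) by nra.
  rewrite ln_mult, ln_Rinv by (try apply Rinv_0_lt_compat; lra).
  assert (HE := ln_entropy_bound t ltac:(lra)).
  assert (HQ := ln_quadratic_lower (a * t) ltac:(lra)).
  assert (HQt : t * (a * t - (a * t) ^ 2 / 2) <= t * ln (1 + a * t))
    by (apply Rmult_le_compat_l; lra).
  unfold z, d in Hln. nra.
Qed.

Lemma Rpower_bernoulli (x p : R) : 0 <= x -> 1 < p -> 1 + p * x <= Rpower (1 + x) p.
Proof.
  intros Hx Hp.
  enough (Rpower (1 + 0) p - (1 + p * 0) <= Rpower (1 + x) p - (1 + p * x)).
  { unfold Rpower at 1 in H. rewrite Rplus_0_r, ln_1, Rmult_0_r, exp_0 in H. lra. }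
  apply incr_of_derive_ge0 with (f := fun x => Rpower (1 + x) p - (1 + p * x))
    (df := fun x => p * Rpower (1 + x) (p - 1) - p); [easy| |].
  - intros y Hy. eapply is_derive_eq.
    + apply (is_derive_minus (V := R_NormedModule)).
      * apply (is_derive_comp (V := R_NormedModule) (fun z => Rpower z p) (fun y => 1 + y)).
        { apply is_derive_Rpower; lra. }
        auto_derive; [easy|reflexivity].
      * auto_derive; [easy|reflexivity].
    + unfold minus, plus, opp, scal; simpl; unfold mult; simpl. ring.
  - intros y Hy.
    assert (1 <= Rpower (1 + y) (p - 1)).
    { rewrite <- (Rpower_O (1 + y)) at 1 by lra. apply Rle_Rpower; lra. }
    nra.
Qed.

(** With [1 / (1 - t^2) = 1 + u], the hypothesis reads [(1 + u) (1 + v) <= y]. Bernoulli is applied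
    to each factor separately, as the cross term [p^2 u v = a u] is needed. *)
Lemma lower_estimate (a p y : R) : 0 < a -> 1 < p -> 0 < y ->
  1 + a * (/ p) ^ 2 <= y * (1 - (/ p) ^ 2) ->
  1 + (1 + a) * p / (p ^ 2 - 1) < Rpower y p.
Proof.
  intros Ha Hp Hy Hyt.
  set (u := / (p ^ 2 - 1)).
  assert (Hp2 : 0 < p ^ 2 - 1) by nra.
  assert (Hu : 0 < u) by now apply Rinv_0_lt_compat.
  assert (Ht : 0 < / p) by (apply Rinv_0_lt_compat; lra).
  set (v := a * (/ p) ^ 2).
  assert (Hv : 0 < v) by (unfold v; apply Rmult_lt_0_compat; [lra|now apply pow_lt]).
  assert (Hle : (1 + u) * (1 + v) <= y).
  { apply Rmult_le_reg_r with (1 - (/ p) ^ 2).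
    - replace (1 - (/ p) ^ 2) with ((p ^ 2 - 1) / p ^ 2) by (field; lra).
      apply Rdiv_lt_0_compat; nra.
    - replace ((1 + u) * (1 + v) * (1 - (/ p) ^ 2)) with (1 + v) by (unfold u; field; lra).
      exact Hyt. }
  apply Rlt_le_trans with (Rpower ((1 + u) * (1 + v)) p).
  2: apply Rle_Rpower_l; [lra|split; [nra|exact Hle]].
  rewrite <- Rpower_mult_distr by lra.
  assert (H1 := Rpower_bernoulli u p ltac:(lra) Hp).
  assert (H2 := Rpower_bernoulli v p ltac:(lra) Hp).
  apply Rlt_le_trans with ((1 + p * u) * (1 + p * v)).
  - replace (p * v) with (a / p) by (unfold v; field; lra).
    replace ((1 + a) * p / (p ^ 2 - 1)) with ((1 + a) * p * u) by (unfold u; field; lra).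
    replace ((1 + p * u) * (1 + a / p)) with (1 + p * u + a / p + a * u) by (field; lra).
    (* After cancellation the claim is [1 / (p + 1) < 1 / p]. *)
    enough (a * (p * u - u) < a * (/ p)) by (unfold Rdiv; lra).
    apply Rmult_lt_compat_l; [lra|].
    replace (p * u - u) with (/ (p + 1)) by (unfold u; field; nra).
    apply Rinv_lt_contravar; nra.
  - apply Rmult_le_compat; nra.
Qed.

Lemma eigenvalue_bounds (p y : R) : 1 < p ->
  (let t := / p in
   1 + (PI ^ 2 / 6) * t ^ 2 + 2 * t ^ 4 * (1 / (1 - t ^ 2) - 1 / (4 * (4 - t ^ 2))) <= y
   <= 1 + (PI ^ 2 / 6) * t ^ 2 + 2 * t ^ 4 * (1 / (1 - t ^ 2))) ->
  p + PI ^ 2 / 6 - 1 - PI ^ 2 / (6 * (p + 1)) < (p - 1) * Rpower y p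
  < p + PI ^ 2 / 6 - 1.
Proof.
  intros Hp Hy'. cbv zeta in Hy'. destruct Hy' as [Hl Hu].
  assert (HPI := PI_bounds).
  set (a := PI ^ 2 / 6 - 1).
  replace (PI ^ 2 / 6) with (1 + a) in * by (unfold a; ring).
  (* The value is about [0.645]; the crude interval is the one that [PI_bounds] yields. *)
  assert (Ha : 6 / 10 < a < 71 / 100) by (unfold a; nra).
  assert (Ht : 0 < / p < 1).
  { split; [apply Rinv_0_lt_compat; lra|]. rewrite <- Rinv_1. apply Rinv_lt_contravar; lra. }
  set (t := / p) in *.
  assert (Hpt : p = / t) by (unfold t; now rewrite Rinv_inv).
  assert (Ht4 : 0 < t ^ 4) by (apply pow_lt; lra).
  assert (Ht2 : 0 < t ^ 2 < 1) by nra.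
  assert (Hfr : 1 / (1 - t ^ 2) - 1 / (4 * (4 - t ^ 2)) > 0).
  { apply Rgt_minus. apply Rmult_lt_compat_l; [lra|]. apply Rinv_lt_contravar; nra. }
  assert (Hy : 0 < y) by nra.
  split.
  - assert (H := lower_estimate a p y ltac:(lra) Hp Hy).
    fold t in H.
    assert (H' : 1 + a * t ^ 2 <= y * (1 - t ^ 2)).
    { apply Rle_trans with ((1 + (1 + a) * t ^ 2 +
        2 * t ^ 4 * (1 / (1 - t ^ 2) - 1 / (4 * (4 - t ^ 2)))) * (1 - t ^ 2));
        [|apply Rmult_le_compat_r; lra].
      (* The bound [1 / 8] is enough: the coefficient of [t^4] is then at least [3 / 4 - a],
         positive since [a < 71 / 100]. *)
      assert (Hq : (1 - t ^ 2) / (4 * (4 - t ^ 2)) <= 1 / 8).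
      { apply Rmult_le_reg_r with (4 * (4 - t ^ 2)); [lra|].
        unfold Rdiv at 1. rewrite Rmult_assoc, Rinv_l by lra. lra. }
      replace ((1 + (1 + a) * t ^ 2 +
        2 * t ^ 4 * (1 / (1 - t ^ 2) - 1 / (4 * (4 - t ^ 2)))) * (1 - t ^ 2)) with
        (1 + a * t ^ 2 + t ^ 4 * (2 - (1 + a) - 2 * ((1 - t ^ 2) / (4 * (4 - t ^ 2)))))
        by (field; lra).
      nra. }
    specialize (H H').
    replace (p + (1 + a) - 1 - PI ^ 2 / (6 * (p + 1))) with
      ((p - 1) * (1 + (1 + a) * p / (p ^ 2 - 1))).
    + apply Rmult_lt_compat_l; lra.
    + unfold a. field. split; nra.
  - assert (H := upper_estimate a t y Ha Ht Hy).
    assert (H' : y * (1 - t ^ 2) <= 1 + a * t ^ 2 + (1 - a) * t ^ 4).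
    { apply Rle_trans with ((1 + (1 + a) * t ^ 2 + 2 * t ^ 4 * (1 / (1 - t ^ 2))) * (1 - t ^ 2));
        [apply Rmult_le_compat_r; lra|].
      right. field. lra. }
    specialize (H H').
    replace (p + (1 + a) - 1) with ((p - 1) * (1 + (1 + a) * t / (1 - t)))
      by (rewrite Hpt; field; split; lra).
    apply Rmult_lt_compat_l; [lra|].
    assert (Hpos : 0 < 1 + (1 + a) * t / (1 - t)).
    { apply Rplus_lt_0_compat; [lra|]. apply Rdiv_lt_0_compat; nra. }
    rewrite <- (exp_ln _ Hpos). unfold Rpower. apply exp_increasing.
    apply Rmult_lt_compat_l with (r := p) in H; [|lra].
    rewrite <- Rmult_assoc in H.
    replace (p * t) with 1 in H by (unfold t; field; lra). lra.
Qed.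

(** * Existence of the first eigenfunction *)

Section Existence.
Variables p q J : R.
Hypothesis Hp : 1 < p.
Hypothesis Hq : 1 < q.
Hypothesis Hpq : (p - 1) * (q - 1) = 1.
Hypothesis HJ : forall w, gen_arctan q w < J.
Hypothesis HJs : forall y, y < J -> exists w, y < gen_arctan q w.

Lemma J_pos : 0 < J.
Proof. rewrite <- (gen_arctan_0 q). apply HJ. Qed.

Lemma gen_arctan_lt_inv (a b : R) : gen_arctan q a < gen_arctan q b -> a < b.
Proof.
  intros H. apply Rnot_le_lt. intros [Hlt|<-]; [|lra].
  generalize (gen_arctan_incr q Hq _ _ Hlt). lra.
Qed.

Lemma gen_arctan_surj (y : R) : - J < y < J -> exists w, gen_arctan q w = y.
Proof.
  intros Hy.
  destruct (HJs y) as [w1 H1]; [lra|]. destruct (HJs (- y)) as [w2 H2]; [lra|].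
  destruct (IVT_gen (gen_arctan q) (- w2) w1 y) as [w [_ Hw]].
  - intros x. apply continuity_pt_filterlim.
    apply (ex_derive_continuous (gen_arctan q) x). eexists; now apply is_derive_gen_arctan.
  - rewrite gen_arctan_opp by assumption. split.
    + eapply Rle_trans; [apply Rmin_l|lra].
    + eapply Rle_trans; [|apply Rmax_r]. lra.
  - now exists w.
Qed.

(** The inverse of [gen_arctan q], meaningful only on [(-J, J)]; elsewhere [epsilon] returns an
    unspecified value. *)
Definition gen_tan (y : R) : R := epsilon (inhabits 0) (fun w => gen_arctan q w = y).

Lemma gen_arctan_tan (y : R) : - J < y < J -> gen_arctan q (gen_tan y) = y.
Proof. intros Hy. apply (epsilon_spec (inhabits 0) _ (gen_arctan_surj y Hy)). Qed.

Lemma is_derive_gen_tan (y : R) : - J < y < J ->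
  is_derive gen_tan y (1 + abs_power q (gen_tan y)).
Proof.
  intros Hy. apply is_derive_Reals.
  set (lb := (y - J) / 2). set (ub := (y + J) / 2).
  assert (Hlb : - J < lb < y) by (unfold lb; lra).
  assert (Hub : y < ub < J) by (unfold ub; lra).
  assert (Hlt : forall u v, - J < u -> u < v -> v < J -> gen_tan u < gen_tan v).
  { intros u v Hu Huv Hv. apply gen_arctan_lt_inv. rewrite !gen_arctan_tan; lra. }
  assert (Hc : continuity_pt gen_tan y).
  { apply (continuity_pt_recip_interv (gen_arctan q) gen_tan (gen_tan lb) (gen_tan ub)).
    - apply Hlt; lra.
    - intros u v _ Huv _. now apply gen_arctan_incr.
    - intros x H1 H2. unfold comp, id. rewrite gen_arctan_tan in H1, H2 by lra.
      apply gen_arctan_tan. lra.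
    - intros x H1 H2. rewrite gen_arctan_tan in H1, H2 by lra. split.
      + destruct H1 as [H1| <-]; [left; apply Hlt; lra|lra].
      + destruct H2 as [H2| ->]; [left; apply Hlt; lra|lra].
    - intros a _. apply continuity_pt_filterlim.
      apply (ex_derive_continuous (gen_arctan q) a). eexists; now apply is_derive_gen_arctan.
    - rewrite !gen_arctan_tan; lra. }
  (* An explicit witness, so that [derive_pt] reduces to the known derivative under [change]. *)
  set (Prf := fun (a : R) (_ : gen_tan lb <= a <= gen_tan ub) =>
    exist _ (/ (1 + abs_power q a)) (proj1 (is_derive_Reals _ _ _) (is_derive_gen_arctan q Hq a))
    : derivable_pt (gen_arctan q) a).
  assert (Hin : gen_tan lb <= gen_tan y <= gen_tan ub) by (split; left; apply Hlt; lra).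
  assert (H := derivable_pt_lim_recip_interv (gen_arctan q) gen_tan lb ub y Prf Hc
    ltac:(lra) ltac:(lra) Hin).
  assert (HA := one_plus_abs_power q (gen_tan y)).
  replace (1 + abs_power q (gen_tan y)) with (1 / derive_pt (gen_arctan q) (gen_tan y) (Prf (gen_tan y) Hin)).
  - apply H.
    + intros x Hx. unfold comp, id. apply gen_arctan_tan. lra.
    + change (/ (1 + abs_power q (gen_tan y)) <> 0). apply Rinv_neq_0_compat. lra.
  - change (1 / / (1 + abs_power q (gen_tan y)) = 1 + abs_power q (gen_tan y)).
    field. lra.
Qed.

Let A (x : R) : R := 1 + abs_power q (gen_tan (J * x)).
(** The analogue of [cos = (1 + tan^2)^(-1/2)]; for [p = 2] it is [cos (PI x / 2)]. *)
Let core (x : R) : R := Rpower (A x) (- / p).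
Let flux_scale : R := Rpower (J / (p - 1)) (p - 1).

Lemma A_ge1 (x : R) : 1 <= A x.
Proof. apply one_plus_abs_power. Qed.

Lemma q_eq : q = p / (p - 1).
Proof. apply Rmult_eq_reg_l with (p - 1); [|lra]. field_simplify; lra. Qed.

Lemma is_derive_gen_tan_scaled (x : R) : - 1 < x < 1 ->
  is_derive (fun x => gen_tan (J * x)) x (J * A x).
Proof.
  intros Hx. assert (HJ0 := J_pos).
  apply (is_derive_comp (V := R_NormedModule) gen_tan (fun x => J * x)).
  - apply is_derive_gen_tan. nra.
  - auto_derive; [easy|ring].
Qed.

Lemma is_derive_A (x : R) : - 1 < x < 1 ->
  is_derive A x (q * signed_power q (gen_tan (J * x)) * (J * A x)).
Proof.
  intros Hx. eapply is_derive_eq.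
  - apply (is_derive_plus (V := R_NormedModule)); [apply @is_derive_const|].
    apply (is_derive_comp (V := R_NormedModule) (abs_power q) (fun x => gen_tan (J * x))).
    + now apply is_derive_abs_power.
    + now apply is_derive_gen_tan_scaled.
  - unfold plus, zero, scal; simpl; unfold mult; simpl. ring.
Qed.

(** The exponent is general because [core] uses [- / p] and its flux [- / q]. *)
Lemma is_derive_A_power (e x : R) : - 1 < x < 1 ->
  is_derive (fun x => Rpower (A x) e) x
    (e * q * J * signed_power q (gen_tan (J * x)) * Rpower (A x) e).
Proof.
  intros Hx. assert (HA := A_ge1 x). eapply is_derive_eq.
  - apply (is_derive_comp (V := R_NormedModule) (fun y => Rpower y e) A).
    + apply is_derive_Rpower. lra.
    + now apply is_derive_A.
  - unfold scal; simpl; unfold mult; simpl.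
    replace (Rpower (A x) e) with (Rpower (A x) (e - 1) * A x).
    + ring.
    + rewrite <- (Rpower_1 (A x)) at 2 by lra. rewrite <- Rpower_plus. f_equal; ring.
Qed.

Let dcore (x : R) : R := - (J / (p - 1)) * signed_power q (gen_tan (J * x)) * core x.

Lemma is_derive_core (x : R) : - 1 < x < 1 -> is_derive core x (dcore x).
Proof.
  intros Hx. eapply is_derive_eq; [now apply is_derive_A_power|].
  unfold dcore, core. rewrite q_eq at 1. field. lra.
Qed.

(** [signed_power p] undoes the [signed_power q] in [dcore]. The flux becomes a product of
    differentiable functions even where [dcore] itself is not differentiable. *)
Lemma signed_power_dcore (x : R) :
  signed_power p (dcore x) = - flux_scale * (gen_tan (J * x) * Rpower (A x) (- / q)).
Proof.
  assert (HJ0 := J_pos).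
  assert (HK : 0 < J / (p - 1)) by (apply Rdiv_lt_0_compat; lra).
  assert (Hc : 0 < core x) by apply exp_pos.
  replace (dcore x) with (J / (p - 1) * (core x * signed_power q (- gen_tan (J * x)))).
  - rewrite !signed_power_scale by assumption.
    rewrite signed_power_conj by (rewrite Rmult_comm; exact Hpq).
    unfold core. rewrite Rpower_mult.
    replace (- / p * (p - 1)) with (- / q) by (rewrite q_eq; field; lra).
    unfold flux_scale. ring.
  - unfold dcore. rewrite signed_power_opp. ring.
Qed.

(** With [w = gen_tan (J x)], the product rule leaves [J A^(-1/q) (A - |w|^q)], whose last factor is
    [1], and [A^(-1/q) = core^(p-1)]. *)
Lemma is_derive_flux (x : R) : - 1 < x < 1 ->
  is_derive (fun x => signed_power p (dcore x)) x
    (- (flux_scale * J) * signed_power p (core x)).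
Proof.
  intros Hx. assert (HA := A_ge1 x).
  eapply is_derive_ext; [intros y; symmetry; apply signed_power_dcore|].
  eapply is_derive_eq.
  - apply is_derive_scal.
    apply (is_derive_mult (fun x => gen_tan (J * x)) (fun x => Rpower (A x) (- / q))).
    + now apply is_derive_gen_tan_scaled.
    + now apply is_derive_A_power.
    + intros; apply Rmult_comm.
  - unfold plus, mult; simpl. rewrite (signed_power_pos p (core x)) by apply exp_pos.
    unfold core. rewrite Rpower_mult.
    replace (- / p * (p - 1)) with (- / q) by (rewrite q_eq; field; lra).
    generalize (Rpower (A x) (- / q)). intros r. unfold A, abs_power. field. lra.
Qed.

(** The value [0] is imposed from [|x| = 1] on, where [gen_tan (J * x)] is unspecified. *)
Definition first_eigenfunction (x : R) : R :=
  if Rlt_dec (Rabs x) 1 then core x else 0.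

Lemma first_eigenfunction_in (x : R) : - 1 < x < 1 -> first_eigenfunction x = core x.
Proof.
  intros Hx. unfold first_eigenfunction.
  destruct (Rlt_dec (Rabs x) 1) as [H|H]; [easy|].
  exfalso. apply H. apply Rabs_def1; lra.
Qed.

Lemma locally_Ioo (x : R) : - 1 < x < 1 -> locally x (fun y => - 1 < y < 1).
Proof.
  intros Hx. apply (open_and (fun y => - 1 < y) (fun y => y < 1)); [apply open_gt|apply open_lt|easy].
Qed.

Lemma is_derive_first_eigenfunction (x : R) : - 1 < x < 1 ->
  is_derive first_eigenfunction x (dcore x).
Proof.
  intros Hx. apply is_derive_ext_loc with core; [|now apply is_derive_core].
  generalize (locally_Ioo x Hx). apply filter_imp.
  intros y Hy. symmetry. now apply first_eigenfunction_in.
Qed.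

Lemma core_small (eps : R) : 0 < eps ->
  exists d, 0 < d /\ forall x, 1 - d < Rabs x < 1 -> core x < eps.
Proof.
  intros He. assert (HJ0 := J_pos).
  (* Chosen so that [M^q = eps^(-p)]: then [|w| > M] forces [A^(-1/p) < eps]. *)
  set (M := Rpower eps (- p / q)).
  assert (HM : 0 < M) by apply exp_pos.
  assert (HGM := HJ M).
  exists (1 - gen_arctan q M / J). split.
  - enough (gen_arctan q M / J < 1) by lra. apply Rmult_lt_reg_r with J; [lra|].
    unfold Rdiv. rewrite Rmult_assoc, Rinv_l; lra.
  - intros x [Hx1 Hx2].
    assert (Hx : gen_arctan q M < J * Rabs x).
    { apply Rmult_lt_reg_r with (/ J); [now apply Rinv_0_lt_compat|].
      replace (J * Rabs x * / J) with (Rabs x) by (field; lra).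
      unfold Rdiv in Hx1. lra. }
    assert (HW : M < gen_tan (J * x) \/ M < - gen_tan (J * x)).
    { apply Rabs_def2 in Hx2.
      assert (HJx : - J < J * x < J) by nra.
      destruct (Rle_dec 0 x) as [H0|H0].
      - left. apply gen_arctan_lt_inv. rewrite gen_arctan_tan by assumption.
        now rewrite Rabs_pos_eq in Hx by assumption.
      - right. apply gen_arctan_lt_inv. rewrite gen_arctan_opp, gen_arctan_tan by assumption.
        rewrite Rabs_left in Hx by lra. lra. }
    assert (Hap : Rpower eps (- p) < abs_power q (gen_tan (J * x))).
    { replace (Rpower eps (- p)) with (Rpower M q).
      2: { unfold M. rewrite Rpower_mult. f_equal. field. lra. }
      destruct HW as [HW|HW].
      - rewrite abs_power_pos by lra. apply Rlt_Rpower_l; lra.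
      - rewrite <- abs_power_opp, abs_power_pos by lra. apply Rlt_Rpower_l; lra. }
    replace eps with (Rpower (Rpower eps (- p)) (- / p)).
    2: { rewrite Rpower_mult. replace (- p * - / p) with 1 by (field; lra). now apply Rpower_1. }
    unfold core. rewrite !Rpower_Ropp.
    assert (H0 : 0 < Rpower eps (- p)) by apply exp_pos.
    rewrite <- (Rpower_Ropp eps p).
    apply Rinv_lt_contravar; [apply Rmult_lt_0_compat; apply exp_pos|].
    apply Rlt_Rpower_l; [apply Rinv_0_lt_compat; lra|]. unfold A. lra.
Qed.

Lemma continuous_on_first_eigenfunction :
  continuous_on (fun x => -1 <= x <= 1) first_eigenfunction.
Proof.
  intros x Hx.
  destruct (Rlt_dec (Rabs x) 1) as [Hlt|Hge].
  - apply Rabs_def2 in Hlt.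
    eapply filterlim_filter_le_1; [apply filter_le_within|].
    apply (ex_derive_continuous (V := R_NormedModule) first_eigenfunction x).
    eexists. apply is_derive_first_eigenfunction. lra.
  - assert (Hf : first_eigenfunction x = 0).
    { unfold first_eigenfunction. now destruct (Rlt_dec (Rabs x) 1). }
    rewrite Hf. apply filterlim_locally. intros eps.
    destruct (core_small eps (cond_pos eps)) as [d [Hd Hs]].
    exists (mkposreal d Hd). intros y Hy Hy1.
    change (Rabs (first_eigenfunction y - 0) < eps).
    change (Rabs (y - x) < d) in Hy.
    unfold first_eigenfunction. destruct (Rlt_dec (Rabs y) 1) as [Hyl|Hyg].
    + rewrite Rminus_0_r, Rabs_pos_eq by apply Rlt_le, exp_pos.
      apply Hs. split; [|easy].
      apply Rnot_lt_le in Hge.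
      generalize (Rabs_triang_inv x y). rewrite <- (Rabs_Ropp (x - y)), Ropp_minus_distr. lra.
    + rewrite Rminus_0_r, Rabs_R0. apply cond_pos.
Qed.

Lemma eigenvalue_scale : eigenvalue p (flux_scale * J).
Proof.
  assert (HD : forall x, - 1 < x < 1 -> Derive first_eigenfunction x = dcore x).
  { intros x Hx. now apply is_derive_unique, is_derive_first_eigenfunction. }
  assert (HF : forall x, - 1 < x < 1 ->
    is_derive (fun y => signed_power p (Derive first_eigenfunction y)) x
      (- (flux_scale * J) * signed_power p (first_eigenfunction x))).
  { intros x Hx. rewrite first_eigenfunction_in by assumption.
    apply is_derive_ext_loc with (fun y => signed_power p (dcore y));
      [|now apply is_derive_flux].
    generalize (locally_Ioo x Hx). apply filter_imp.
    intros y Hy. now rewrite HD. }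
  exists first_eigenfunction. repeat split.
  - apply continuous_on_first_eigenfunction.
  - intros x Hx. eexists. now apply is_derive_first_eigenfunction.
  - eexists. now apply HF.
  - assert (E := is_derive_unique _ _ _ (HF x H)).
    etransitivity; [apply f_equal, E|ring].
  - unfold first_eigenfunction. rewrite Rabs_left by lra.
    destruct (Rlt_dec (- -1) 1); [exfalso; lra|easy].
  - unfold first_eigenfunction. rewrite Rabs_pos_eq by lra.
    destruct (Rlt_dec 1 1); [exfalso; lra|easy].
  - exists 0. split; [lra|]. rewrite first_eigenfunction_in by lra.
    apply Rgt_not_eq, exp_pos.
Qed.

End Existence.

(** * Minimality of the first eigenvalue *)

(** Continuity relative to the closed interval, as an eigenfunction is unconstrained outside; at an
    end point only one side counts. *)
Definition eps_continuous_on (a b : R) (f : R -> R) : Prop :=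
  forall x, a <= x <= b -> forall eps, 0 < eps -> exists d, 0 < d /\
    forall y, a <= y <= b -> Rabs (y - x) < d -> Rabs (f y - f x) < eps.

Lemma continuous_on_eps (a b : R) (f : R -> R) :
  continuous_on (fun x => a <= x <= b) f -> eps_continuous_on a b f.
Proof.
  intros H x Hx eps He. specialize (H x Hx).
  apply filterlim_locally with (eps := mkposreal eps He) in H.
  destruct H as [d Hd]. exists d. split; [apply cond_pos|].
  intros y Hy Hyx. apply (Hd y Hyx Hy).
Qed.

(** Lets statements about the nearest zero on the right serve on the left as well. *)
Lemma eps_continuous_on_reflect (c : R) (f : R -> R) :
  eps_continuous_on (- c) c f -> eps_continuous_on (- c) c (fun x => f (- x)).
Proof.
  intros H x Hx eps He. destruct (H (- x) ltac:(lra) eps He) as [d [Hd Hf]].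
  exists d. split; [easy|]. intros y Hy Hyx. apply Hf; [lra|].
  replace (- y - - x) with (- (y - x)) by ring. now rewrite Rabs_Ropp.
Qed.

(** [c] is the supremum of the points up to which [f] stays positive from [x0]; continuity excludes
    either sign of [f c]. *)
Lemma first_zero (a b x0 : R) (f : R -> R) :
  eps_continuous_on a b f -> a <= x0 <= b -> 0 < f x0 -> f b = 0 ->
  exists c, x0 < c <= b /\ f c = 0 /\ forall y, x0 <= y < c -> 0 < f y.
Proof.
  intros Hc Hx0 Hf0 Hfb.
  set (E := fun x => x0 <= x <= b /\ forall y, x0 <= y <= x -> 0 < f y).
  destruct (completeness E) as [c [Hc1 Hc2]].
  - exists b. intros x [Hx _]. lra.
  - exists x0. split; [lra|]. intros y Hy. now replace y with x0 by lra.
  - assert (Hx0E : E x0).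
    { split; [lra|]. intros y Hy. now replace y with x0 by lra. }
    assert (Hx0c : x0 <= c) by now apply Hc1.
    assert (Hcb : c <= b) by (apply Hc2; intros x [Hx _]; lra).
    assert (Hpos : forall y, x0 <= y < c -> 0 < f y).
    { intros y Hy. apply NNPP. intros Hn.
      enough (c <= y) by lra. apply Hc2. intros x [Hx Hxp].
      apply Rnot_lt_le. intros Hlt. apply Hn, Hxp. lra. }
    assert (Hnpos : ~ 0 < f c).
    { intros Hfc.
      assert (Hcb' : c < b) by (destruct Hcb as [H| ->]; lra).
      destruct (Hc c ltac:(lra) (f c) Hfc) as [d [Hd Hfd]].
      set (e := Rmin (c + d / 2) b).
      assert (He : c < e <= b /\ e <= c + d / 2).
      { unfold e. split; [split|].
        - apply Rmin_glb_lt; lra.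
        - apply Rmin_r.
        - apply Rmin_l. }
      enough (E e) by (specialize (Hc1 e H); lra).
      split; [lra|]. intros y Hy. destruct (Rlt_dec y c) as [Hyc|Hyc]; [apply Hpos; lra|].
      assert (H := Hfd y ltac:(lra) ltac:(rewrite Rabs_pos_eq; lra)).
      apply Rabs_def2 in H. lra. }
    assert (Hx0c' : x0 < c) by (destruct Hx0c as [H| <-]; [easy|lra]).
    exists c. split; [lra|split; [|easy]].
    destruct (Rtotal_order (f c) 0) as [Hneg|[Hz|Hp]]; [exfalso|easy|lra].
    destruct (Hc c ltac:(lra) (- f c) ltac:(lra)) as [d [Hd Hfd]].
    set (y := Rmax x0 (c - d / 2)).
    assert (Hy : x0 <= y < c /\ c - d / 2 <= y).
    { unfold y. split; [split|].
      - apply Rmax_l.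
      - apply Rmax_lub_lt; lra.
      - apply Rmax_r. }
    assert (H := Hfd y ltac:(lra) ltac:(rewrite Rabs_left; lra)).
    specialize (Hpos y ltac:(lra)). apply Rabs_def2 in H. lra.
Qed.

(* If [f' >= - K f] up to a zero [c] of [f], then [f e^(K x)] is nondecreasing and
   [f] cannot reach [0]. *)
Lemma log_derivative_unbounded (a b x0 c K : R) (f : R -> R) :
  eps_continuous_on a b f -> a <= x0 < c -> c <= b -> f c = 0 ->
  (forall x, x0 <= x < c -> 0 < f x) -> (forall x, x0 <= x < c -> ex_derive f x) ->
  exists x, x0 < x < c /\ Derive f x / f x < - K.
Proof.
  intros Hc Hx0 Hcb Hfc Hpos Hd.
  apply NNPP. intros Hn.
  assert (HK : forall x, x0 < x < c -> - K * f x <= Derive f x).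
  { intros x Hx. apply Rnot_lt_le. intros Hlt. apply Hn. exists x. split; [easy|].
    assert (Hfx := Hpos x ltac:(lra)).
    apply Rmult_lt_reg_r with (f x); [easy|].
    unfold Rdiv. rewrite Rmult_assoc, Rinv_l; lra. }
  set (x1 := (x0 + c) / 2).
  assert (Hx1 : x0 < x1 < c) by (unfold x1; lra).
  assert (Hmono : forall x, x1 <= x < c -> f x1 * exp (K * x1) <= f x * exp (K * x)).
  { intros x Hx.
    apply incr_of_derive_ge0 with (f := fun x => f x * exp (K * x))
      (df := fun x => (Derive f x + K * f x) * exp (K * x)); [lra| |].
    - intros y Hy. auto_derive; [apply Hd; lra|].
      change (fun x => f x) with f. ring.
    - intros y Hy. apply Rmult_le_pos; [|apply Rlt_le, exp_pos].
      specialize (HK y ltac:(lra)). lra. }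
  set (B := Rmax (exp (K * x1)) (exp (K * c))).
  assert (HB : forall x, x1 <= x < c -> exp (K * x) <= B).
  { intros x Hx. unfold B. destruct (Rle_dec 0 K) as [H0|H0].
    - eapply Rle_trans; [|apply Rmax_r]. apply Rnot_lt_le. intros Hl. apply exp_lt_inv in Hl. nra.
    - eapply Rle_trans; [|apply Rmax_l]. apply Rnot_lt_le. intros Hl. apply exp_lt_inv in Hl. nra. }
  assert (HB0 : 0 < B) by (eapply Rlt_le_trans; [apply exp_pos|apply Rmax_l]).
  (* By [Hmono], [f] stays above [eta] on [[x1, c)]. [B] bounds the exponential for either sign of
     [K]. *)
  set (eta := f x1 * exp (K * x1) / B).
  assert (Heta : 0 < eta).
  { apply Rdiv_lt_0_compat; [|easy]. apply Rmult_lt_0_compat; [apply Hpos; lra|apply exp_pos]. }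
  destruct (Hc c ltac:(lra) eta Heta) as [d [Hd0 Hfd]].
  set (x := Rmax x1 (c - d / 2)).
  assert (Hx : x1 <= x < c /\ c - d / 2 <= x).
  { unfold x. split; [split|].
    - apply Rmax_l.
    - apply Rmax_lub_lt; lra.
    - apply Rmax_r. }
  assert (H := Hfd x ltac:(lra) ltac:(rewrite Rabs_left; lra)).
  rewrite Hfc, Rminus_0_r in H. apply Rabs_def2 in H.
  assert (Hfx := Hpos x ltac:(lra)).
  assert (H1 := Hmono x ltac:(lra)).
  assert (H2 : f x * exp (K * x) <= f x * B) by (apply Rmult_le_compat_l; [lra|apply HB; lra]).
  assert (H3 : eta * B = f x1 * exp (K * x1)) by (unfold eta; field; lra).
  nra.
Qed.

Lemma eigenfunction_opp (p mu : R) (phi : R -> R) :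
  eigenfunction p mu phi -> eigenfunction p mu (fun x => - phi x).
Proof.
  intros (Hc & Hd & He & Hl & Hr & x0 & Hx0 & Hn).
  assert (HD : forall y, signed_power p (Derive (fun x => - phi x) y)
    = - signed_power p (Derive phi y))
    by (intros y; rewrite Derive_opp; apply signed_power_opp).
  repeat split.
  - intros x Hx. eapply filterlim_comp; [apply Hc, Hx|].
    apply (filterlim_opp (V := R_NormedModule)).
  - intros x Hx. apply (ex_derive_opp (V := R_NormedModule)), Hd, Hx.
  - apply (ex_derive_ext (fun y => - signed_power p (Derive phi y)));
      [intros y; symmetry; apply HD|].
    apply (ex_derive_opp (V := R_NormedModule)), He, H.
  - rewrite (Derive_ext _ _ x HD), Derive_opp, signed_power_opp.
    destruct (He x H) as [_ E]. lra.
  - rewrite Hl. ring.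
  - rewrite Hr. ring.
  - exists x0. split; [easy|lra].
Qed.

Section Minimality.
Variables p q J : R.
Hypothesis Hp : 1 < p.
Hypothesis Hq : 1 < q.
Hypothesis Hpq : (p - 1) * (q - 1) = 1.
Hypothesis HJ : forall w, gen_arctan q w < J.
Hypothesis HJs : forall y, y < J -> exists w, y < gen_arctan q w.

Let kappa : R := Rpower (J / (p - 1)) (p - 1).

Lemma kappa_pos : 0 < kappa.
Proof. apply exp_pos. Qed.

Lemma signed_power_gt (s K : R) : 0 < K -> K < s -> Rpower K (p - 1) < signed_power p s.
Proof.
  intros HK Hs. rewrite signed_power_pos by lra. apply Rlt_Rpower_l; lra.
Qed.

(** [kappa] is chosen so that [kappa^(q-1) = J / (p-1)]; this normalises the Riccati equation. *)
Lemma kappa_abs_power (z : R) :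
  (p - 1) * abs_power q (kappa * z) = kappa * J * abs_power q z.
Proof.
  assert (HJ0 : 0 < J) by (rewrite <- (gen_arctan_0 q); apply HJ).
  unfold abs_power. rewrite signed_power_scale by apply kappa_pos.
  unfold kappa at 1. rewrite Rpower_mult, Hpq, Rpower_1 by (apply Rdiv_lt_0_compat; lra).
  field. lra.
Qed.

Section Comparison.
Variables (mu : R) (phi : R -> R).
Hypothesis Hphi : eigenfunction p mu phi.
Hypothesis Hmu : mu < kappa * J.

(* Riccati variable; for [mu = kappa * J], dividing by [kappa] turns its equation
   into [z' = - J (1 + |z|^q)]. *)
Let z (x : R) : R := signed_power p (Derive phi x) * Rpower (phi x) (1 - p) / kappa.

Lemma z_eq (x : R) : 0 < phi x -> kappa * z x = signed_power p (Derive phi x / phi x).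
Proof.
  intros Hx. unfold Rdiv.
  rewrite (Rmult_comm (Derive phi x)), signed_power_scale by now apply Rinv_0_lt_compat.
  replace (Rpower (/ phi x) (p - 1)) with (Rpower (phi x) (1 - p)).
  - unfold z. field. apply Rgt_not_eq, kappa_pos.
  - unfold Rpower. rewrite ln_Rinv by assumption. f_equal. ring.
Qed.

(** The derivative of the flux contributes [- mu]. That of [phi^(1-p)] contributes
    [-(p-1) |kappa z|^q], because [phi' / phi] is [signed_power q (kappa z)]. *)
Lemma is_derive_z (x : R) : - 1 < x < 1 -> 0 < phi x ->
  is_derive z x (- mu / kappa - J * abs_power q (z x)).
Proof.
  intros Hx Hpos. destruct Hphi as (_ & Hd & He & _).
  destruct (He x Hx) as [Hf1 Hf2].
  assert (Hk := kappa_pos).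
  assert (Hdp := Derive_correct _ _ (Hd x Hx)).
  eapply is_derive_eq.
  - apply (is_derive_ext (fun x => / kappa *
      (signed_power p (Derive phi x) * Rpower (phi x) (1 - p)))).
    { intros y. unfold z, Rdiv. apply Rmult_comm. }
    apply is_derive_scal.
    apply (is_derive_mult (fun y => signed_power p (Derive phi y))
      (fun y => Rpower (phi y) (1 - p))).
    + apply Derive_correct, Hf1.
    + apply (is_derive_comp (V := R_NormedModule) (fun y => Rpower y (1 - p)) phi).
      * now apply is_derive_Rpower.
      * exact Hdp.
    + intros; apply Rmult_comm.
  - unfold plus, mult, scal; simpl; unfold mult; simpl.
    set (flux := signed_power p (Derive phi x)) in *.
    replace (Derive (fun y => signed_power p (Derive phi y)) x)
      with (- mu * Rpower (phi x) (p - 1))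
      by (rewrite signed_power_pos in Hf2 by assumption; lra).
    assert (H1 : Rpower (phi x) (p - 1) * Rpower (phi x) (1 - p) = 1).
    { rewrite <- Rpower_plus. replace (p - 1 + (1 - p)) with 0 by ring. now apply Rpower_O. }
    assert (H2 : Rpower (phi x) (1 - p - 1) = Rpower (phi x) (1 - p) / phi x).
    { unfold Rminus at 1. rewrite Rpower_plus, Rpower_Ropp, Rpower_1; easy. }
    assert (H3 : J * abs_power q (z x)
      = (p - 1) * (flux * Rpower (phi x) (1 - p) * (Derive phi x / phi x)) / kappa).
    { transitivity ((p - 1) * abs_power q (kappa * z x) / kappa).
      - rewrite kappa_abs_power. field. lra.
      - unfold abs_power. rewrite (z_eq x Hpos) at 1.
        rewrite signed_power_conj by assumption. unfold z, flux. field. lra. }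
    rewrite H3, H2.
    replace (- mu / kappa) with
      (- mu * (Rpower (phi x) (p - 1) * Rpower (phi x) (1 - p)) / kappa)
      by (rewrite H1; field; lra).
    field. lra.
Qed.

Lemma comparison_absurd (x0 : R) : - 1 <= x0 <= 1 -> 0 < phi x0 -> False.
Proof.
  intros Hx0 Hpos0. destruct Hphi as (Hc & Hd & _ & Hl & Hr & _).
  assert (Hk := kappa_pos).
  assert (HC := continuous_on_eps _ _ _ Hc).
  assert (HC' := eps_continuous_on_reflect 1 phi HC).
  destruct (first_zero (-1) 1 x0 phi HC Hx0 Hpos0 Hr) as [b (Hb & Hfb & Hpb)].
  destruct (first_zero (-1) 1 (- x0) (fun x => phi (- x)) HC') as [a' (Ha & Hfa & Hpa)];
    [lra|now rewrite Ropp_involutive|exact Hl|].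
  set (a := - a') in *.
  assert (Hpos : forall x, a < x < b -> 0 < phi x).
  { intros x Hx. destruct (Rle_dec x0 x) as [H|H]; [apply Hpb; lra|].
    replace x with (- - x) by ring. apply Hpa. unfold a in *. lra. }
  assert (Hab : -1 <= a < x0 /\ x0 < b <= 1) by (unfold a; lra).
  (* [D] would be constant for [mu = kappa * J]; for smaller [mu] it increases strictly, although
     [gen_arctan q (z x)] must fall by almost [2 J] over a length of at most [2]. *)
  set (D := fun x => gen_arctan q (z x) + J * x).
  assert (HD : forall u v, a < u -> u < v -> v < b -> D u < D v).
  { intros u v Hu Huv Hv.
    apply strict_incr_of_derive_pos with
      (df := fun x => (J - mu / kappa) / (1 + abs_power q (z x))); [easy| |].
    - intros x Hx. assert (HA := one_plus_abs_power q (z x)).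
      eapply is_derive_eq.
      + apply (is_derive_plus (V := R_NormedModule)).
        * apply (is_derive_comp (V := R_NormedModule) (gen_arctan q) z).
          { now apply is_derive_gen_arctan. }
          apply is_derive_z; [lra|apply Hpos; lra].
        * apply (is_derive_scal (fun x => x)), (@is_derive_id R_AbsRing).
      + unfold plus, scal, one; simpl; unfold mult; simpl. field. lra.
    - intros x Hx. assert (HA := one_plus_abs_power q (z x)).
      apply Rdiv_lt_0_compat; [|lra].
      enough (mu / kappa < J) by lra.
      apply Rmult_lt_reg_r with kappa; [lra|].
      unfold Rdiv. rewrite Rmult_assoc, Rinv_l; lra. }
  (* The gain [d] is fixed before [m]: each end then misses the full drop by less than [d / 2], so
     the total increase of [D] stays below [d], yet it exceeds the gain from [x0] to [x1]. *)
  set (x1 := (x0 + b) / 2). set (d := D x1 - D x0).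
  assert (Hd0 : 0 < d) by (generalize (HD x0 x1); unfold d, x1; lra).
  destruct (HJs (J - d / 2)) as [m' Hm']; [lra|].
  set (m := Rmax m' 1).
  assert (Hm : 1 <= m) by apply Rmax_r.
  assert (HGm : J - d / 2 < gen_arctan q m).
  { destruct (Rmax_l m' 1) as [H|H]; fold m in H.
    - generalize (gen_arctan_incr q Hq _ _ H); lra.
    - rewrite <- H; lra. }
  (* Chosen so that [K^(p-1) = kappa m]: a logarithmic derivative beyond [K] in size puts [|z|]
     beyond [m]. *)
  set (K := Rpower (kappa * m) (q - 1)).
  assert (HK : 0 < K) by apply exp_pos.
  assert (Hkm : 0 < kappa * m) by (apply Rmult_lt_0_compat; lra).
  assert (HKp : Rpower K (p - 1) = kappa * m)
    by (unfold K; rewrite Rpower_mult, (Rmult_comm (q - 1)), Hpq; now apply Rpower_1).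
  destruct (log_derivative_unbounded (-1) 1 x1 b K phi HC) as [v [Hv Hv']].
  { unfold x1; lra. } { lra. } { easy. }
  { intros; apply Hpos; unfold x1 in *; lra. } { intros; apply Hd; unfold x1 in *; lra. }
  destruct (log_derivative_unbounded (-1) 1 (- x0) a' K (fun x => phi (- x)) HC')
    as [u' [Hu Hu']].
  { lra. } { lra. } { easy. } { easy. }
  { intros x Hx. auto_derive. apply Hd. lra. }
  assert (Hvz : z v < - m).
  { assert (Hv0 : 0 < phi v) by (apply Hpos; unfold x1 in *; lra).
    assert (H := signed_power_gt (- (Derive phi v / phi v)) K HK ltac:(lra)).
    rewrite signed_power_opp, <- z_eq, HKp in H by assumption. nra. }
  assert (Huz : m < z (- u')).
  { assert (Hu0 : 0 < phi (- u')) by (apply Hpa; lra).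
    assert (HDu : Derive (fun x => phi (- x)) u' = - Derive phi (- u')).
    { apply is_derive_unique. auto_derive.
      - apply Hd. lra.
      - change (fun x => phi x) with phi. ring. }
    rewrite HDu in Hu'. unfold Rdiv in Hu'. rewrite <- Ropp_mult_distr_l in Hu'.
    assert (H := signed_power_gt (Derive phi (- u') / phi (- u')) K HK
      ltac:(unfold Rdiv; lra)).
    rewrite <- z_eq, HKp in H by assumption. nra. }
  assert (HDv : D x1 < D v) by (apply HD; unfold x1 in *; lra).
  assert (HDu : D (- u') < D x0) by (apply HD; unfold a in *; lra).
  assert (HGv := gen_arctan_incr q Hq _ _ Hvz). rewrite gen_arctan_opp in HGv by assumption.
  assert (HGu := gen_arctan_incr q Hq _ _ Huz).
  assert (HJ0 : 0 < J) by (rewrite <- (gen_arctan_0 q); apply HJ).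
  assert (Hlen : J * v - J * - u' <= 2 * J) by nra.
  unfold d, D in *. lra.
Qed.
End Comparison.

Lemma eigenvalue_ge (mu : R) : eigenvalue p mu -> kappa * J <= mu.
Proof.
  intros [phi Hphi]. apply Rnot_lt_le. intros Hmu.
  assert (H := Hphi). destruct H as (_ & _ & _ & _ & _ & x0 & Hx0 & Hn).
  destruct (Rtotal_order (phi x0) 0) as [Hneg|[Hz|Hpos]]; [|easy|].
  - apply (comparison_absurd mu (fun x => - phi x) (eigenfunction_opp _ _ _ Hphi) Hmu x0);
      [easy|lra].
  - now apply (comparison_absurd mu phi Hphi Hmu x0).
Qed.
End Minimality.

(** * The first eigenvalue *)

Lemma lambda_bounds (p : R) : 1 < p ->
  p + PI ^ 2 / 6 - 1 - PI ^ 2 / (6 * (p + 1)) < lambda p < p + PI ^ 2 / 6 - 1.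
Proof.
  intros Hp.
  set (q := p / (p - 1)).
  assert (Hpq : (p - 1) * (q - 1) = 1) by (unfold q; field; lra).
  assert (Hq : 1 < q) by nra.
  destruct (gen_arctan_limit q Hq) as [J (HJ & HJs & Hser)].
  assert (HJ0 : 0 < J) by (rewrite <- (gen_arctan_0 q); apply HJ).
  set (lam := Rpower (J / (p - 1)) (p - 1) * J).
  assert (Hfirst : first_eigenvalue p lam).
  { split.
    - now apply (eigenvalue_scale p q J).
    - now apply (eigenvalue_ge p q J). }
  assert (Hlam : lambda p = lam).
  { assert (H : first_eigenvalue p (lambda p))
      by (unfold lambda; apply epsilon_spec; now exists lam).
    apply Rle_antisym; [apply H|apply Hfirst]; [apply Hfirst|apply H]. }
  assert (Hpow : lam = (p - 1) * Rpower (J / (p - 1)) p).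
  { replace (Rpower (J / (p - 1)) p) with
      (Rpower (J / (p - 1)) (p - 1) * (J / (p - 1))).
    - unfold lam. field. lra.
    - rewrite <- (Rpower_1 (J / (p - 1))) at 2 by (apply Rdiv_lt_0_compat; lra).
      rewrite <- Rpower_plus. f_equal. ring. }
  rewrite Hlam, Hpow.
  apply eigenvalue_bounds; [exact Hp|].
  assert (Ht : 0 < / p < 1).
  { split; [apply Rinv_0_lt_compat; lra|].
    rewrite <- Rinv_1. apply Rinv_lt_contravar; lra. }
  assert (H := pi_p_bounds (/ p) q J Ht). cbv zeta in H |- *.
  replace (J / (p - 1)) with (J * / p / (1 - / p)) by (field; lra).
  apply H; [unfold q; field; lra|exact Hser].
Qed.

Theorem theorem3p5 :
  (forall p : R, 1 < p ->
     p + PI ^ 2 / 6 - 1 - PI ^ 2 / (6 * (p + 1)) < lambda p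
     < p + PI ^ 2 / 6 - 1)
  /\ is_lim (fun p : R => lambda p - p) p_infty (PI ^ 2 / 6 - 1).
Proof.
  split; [exact lambda_bounds|].
  apply is_lim_le_le_loc with
    (f := fun p => PI ^ 2 / 6 - 1 - PI ^ 2 / 6 * / (p + 1))
    (g := fun _ => PI ^ 2 / 6 - 1).
  - exists 1. intros p Hp. destruct (lambda_bounds p Hp) as [H1 H2].
    replace (PI ^ 2 / (6 * (p + 1))) with (PI ^ 2 / 6 * / (p + 1)) in H1 by (field; lra).
    lra.
  - replace (Finite (PI ^ 2 / 6 - 1)) with (Finite (PI ^ 2 / 6 - 1 - PI ^ 2 / 6 * 0))
      by (f_equal; ring).
    apply is_lim_minus'; [apply is_lim_const|].
    apply (is_lim_scal_l (fun p => / (p + 1)) _ p_infty 0).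
    apply (is_lim_inv (fun p => p + 1) p_infty p_infty); [|easy].
    apply (is_lim_plus (fun p => p) (fun _ => 1) p_infty p_infty 1);
      [apply is_lim_id|apply is_lim_const|easy].
  - apply is_lim_const.
Qed.
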